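(* Let $d\ge1$ and $C_A,C_R,\ell_A,\ell_R>0$. Consider the following potentials on $\mathbb{R}^d$: (i) (power-law potential) $W(x)=\dfrac{|x|^a}{a}-\dfrac{|x|^b}{b}$ with $a,b\in\mathbb{R}$, $-d<b<a$, and the convention $\frac{|x|^0}{0}=\log|x|$; (ii) (Morse potential) $W(x)=C_R e^{-|x|/\ell_R}-C_A e^{-|x|/\ell_A}$ with $\ell_R<\ell_A$ and $\frac{C_R}{C_A}<\left(\frac{\ell_A}{\ell_R}\right)^d$. Each of these potentials $W:\mathbb{R}^d\to\mathbb{R}\cup\{+\infty\}$ satisfies all of the following properties: (1) $W$ is bounded from below by a finite constant $W_{\min}<0$; (2) $W$ is locally integrable, i.e. $\int_B |W|<+\infty$ for every open ball $B\subset\mathbb{R}^d$; (3) $W(x)=W(-x)$ for all $x\in\mathbb{R}^d$; (4) the limit $W_\infty:=\lim_{|x|\to\infty}W(x)$ exists (possibly equal to $+\infty$) and there is $\mu\in\mathcal{P}(\mathbb{R}^d)$ with $E(\mu)<\frac12 W_\infty$; (5) $W$ is lower semi-continuous; (6) there is $R_6>0$ such that, for every $k\in\{1,\dots,d\}$, $W$ is strictly increasing on $\mathbb{R}^{k-1}\times[R_6,\infty)\times\mathbb{R}^{d-k}$ as a function of its $k$-th variable.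
   Context: $\mathcal{P}(\mathbb{R}^d)$ denotes the set of (Borel) probability measures on $\mathbb{R}^d$, and for a potential $W$ bounded from below the interaction energy is $E(\rho)=\frac12\int_{\mathbb{R}^d\times\mathbb{R}^d}W(x-y)\,d\rho(x)\,d\rho(y)\in\mathbb{R}\cup\{+\infty\}$ for $\rho\in\mathcal{P}(\mathbb{R}^d)$. In (i), the value $W(0)$ is understood as $\lim_{x\to0}W(x)$, i.e. $W(0)=0$ if $b>0$ and $W(0)=+\infty$ if $b\le 0$. *)

(* Defs.v *)
From HB Require Import structures.
From mathcomp Require Import all_boot all_order all_algebra.
From mathcomp Require Import all_classical all_reals all_analysis.
From mathcomp Require Import measurable_realfun.

Set Implicit Arguments.
Unset Strict Implicit.
Unset Printing Implicit Defensive.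

Import Order.TTheory GRing.Theory Num.Theory.
Import numFieldNormedType.Exports.

Local Open Scope classical_set_scope.
Local Open Scope ring_scope.

(* Row vectors carry the Borel sigma-algebra. *)
Section borel_rV.
Context (R : realType) (n : nat).

HB.instance Definition _ := @isMeasurable.Build (sigma_display (@open 'rV[R]_n))
  'rV[R]_n <<s (@open 'rV[R]_n) >>
  (@sigma_algebra0 _ setT (@open 'rV[R]_n))
  (@sigma_algebraC _ (@open 'rV[R]_n))
  (@sigma_algebra_bigcup _ setT (@open 'rV[R]_n)).

Lemma open_measurable_rV (A : set 'rV[R]_n) : open A -> measurable A.
Proof. by move=> oA; exact: sub_sigma_algebra. Qed.

Lemma measurable_coord (i : 'I_n) :
  measurable_fun setT (fun v : 'rV[R]_n => v ord0 i).
Proof.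
apply: (measurability _ (RGenOpens.measurableE R)) => _ [_ [a [b ->] <-]].
rewrite setTI; apply: open_measurable_rV.
apply: open_comp; last exact: interval_open.
by move=> v _; exact: coord_continuous.
Qed.

Lemma open_rV_bigcup (U : set 'rV[R]_n) : open U ->
  U = \bigcup_(p in [set p : 'rV[rat]_n * nat |
        ball (map_mx ratr p.1 : 'rV[R]_n) (p.2.+1%:R^-1) `<=` U])
      ball (map_mx ratr p.1 : 'rV[R]_n) (p.2.+1%:R^-1).
Proof.
move=> oU; apply/seteqP; split=> [x Ux|x [p pU] px]; last exact: pU.
have /nbhs_ballP[e/= e0 xeU] : nbhs x U by exact: open_nbhs_nbhs.
have [k ke] : exists k : nat, k.+1%:R^-1 < e / 2.
  have /ltr_add_invr[k] : 0 < e / 2 by rewrite divr_gt0.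
  by rewrite add0r => ke; exists k.
have k0 : 0 < k.+1%:R^-1 :> R by rewrite invr_gt0.
have q_ i : exists q : rat, ball (ratr q : R) k.+1%:R^-1 (x ord0 i).
  have /rat_in_itvoo[q] :
      x ord0 i - k.+1%:R^-1 < x ord0 i + k.+1%:R^-1.
    by rewrite ltrD2l gtrN.
  rewrite in_itv/= => /andP[q1 q2].
  by exists q; rewrite /ball/= distrC ltr_distlC q1 q2.
pose q : 'rV[rat]_n := \row_i sval (cid (q_ i)).
have qx : ball (map_mx ratr q : 'rV[R]_n) k.+1%:R^-1 x.
  by split => // i j; rewrite ord1 !mxE; case: cid.
exists (q, k) => //= y qy; apply: xeU.
rewrite (splitr e); apply: ball_triangle (le_ball (ltW ke) _) (le_ball (ltW ke) qy).
exact/ball_sym.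
Qed.

Lemma measurable_fun_rVP d (T : measurableType d) (f : T -> 'rV[R]_n) :
  (forall i, measurable_fun setT (fun t => f t ord0 i)) ->
  measurable_fun setT f.
Proof.
move=> mf.
apply: (@measurability _ _ _ 'rV[R]_n setT f (@open 'rV[R]_n)) => //.
move=> _ [U oU <-]; rewrite setTI (open_rV_bigcup oU) preimage_bigcup.
rewrite bigcup_mkcond; apply: countable_bigcupT_measurable => // p.
case: ifPn => // _.
rewrite (_ : _ @^-1` _ = \bigcap_(i in [set: 'I_n])
    ((fun t => f t ord0 i) @^-1` ball (ratr (p.1 ord0 i) : R) p.2.+1%:R^-1)).
  rewrite -[X in measurable X]setCK setC_bigcap; apply: measurableC.
  apply: fin_bigcup_measurable => [|i _]; first exact: finite_finset.
  apply: measurableC; rewrite -[X in measurable X]setTI.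
  by apply: mf => //; apply: open_measurable; exact: ball_open.
apply/seteqP; split=> [t [_ pt] i _|t pt].
  by have := pt ord0 i; rewrite mxE.
by split=> // i j; rewrite ord1 mxE; exact: pt.
Qed.

End borel_rV.

Section rV_cons.
Context (R : realType) (n : nat).

Definition rV_cons (p : R * 'rV[R]_n) : 'rV[R]_n.+1 :=
  \row_i oapp (fun j => p.2 ord0 j) p.1 (unlift ord0 i).

Definition rV_split (v : 'rV[R]_n.+1) : R * 'rV[R]_n :=
  (v ord0 ord0, \row_i v ord0 (lift ord0 i)).

Lemma rV_cons0 p : rV_cons p ord0 ord0 = p.1.
Proof. by rewrite mxE unlift_none. Qed.

Lemma rV_consS p i : rV_cons p ord0 (lift ord0 i) = p.2 ord0 i.
Proof. by rewrite mxE liftK. Qed.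

Lemma rV_consK : cancel rV_cons rV_split.
Proof.
move=> [x v]; rewrite /rV_split rV_cons0; congr pair.
by apply/rowP => i; rewrite mxE rV_consS.
Qed.

Lemma measurable_rV_cons : measurable_fun setT rV_cons.
Proof.
apply: measurable_fun_rVP => i; have [j ->|->] := unliftP ord0 i.
  under eq_fun do rewrite rV_consS.
  by apply: (@measurableT_comp _ _ _ _ _ _ (fun v : 'rV[R]_n => v ord0 j) _ snd);
    [exact: measurable_coord|exact: measurable_snd].
by under eq_fun do rewrite rV_cons0; exact: measurable_fst.
Qed.

Lemma measurable_rV_split : measurable_fun setT rV_split.
Proof.
apply: measurable_fun_pair; first exact: measurable_coord.
apply: measurable_fun_rVP => i.
by under eq_fun do rewrite mxE; exact: measurable_coord.
Qed.

End rV_cons.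

Section lebesgue_rV.
Context (R : realType).

Section step.
Context (n : nat) (m : {sigma_finite_measure set 'rV[R]_n -> \bar R}).

Definition lebesgue_rV_step : set 'rV[R]_n.+1 -> \bar R :=
  pushforward (@lebesgue_measure R \x m)%E (@rV_cons R n).

Let step0 : lebesgue_rV_step set0 = 0%E.
Proof. by rewrite /lebesgue_rV_step /pushforward preimage_set0 measure0. Qed.

Let step_ge0 A : (0 <= lebesgue_rV_step A)%E.
Proof. exact: (measure_ge0 (@lebesgue_measure R \x m)%E). Qed.

Let step_sigma_additive : semi_sigma_additive lebesgue_rV_step.
Proof.
move=> F mF tF mUF; rewrite /lebesgue_rV_step /pushforward preimage_bigcup.
apply: measure_semi_sigma_additive.
- by move=> k; rewrite -[X in measurable X]setTI; exact: measurable_rV_cons.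
- apply/trivIsetP => /= i j _ _ ij; rewrite -preimage_setI.
  by move/trivIsetP : tF => /(_ _ _ _ _ ij) ->//; rewrite preimage_set0.
- rewrite -preimage_bigcup -[X in measurable X]setTI.
  exact: measurable_rV_cons.
Qed.

HB.instance Definition _ := isMeasure.Build _ _ _
  lebesgue_rV_step step0 step_ge0 step_sigma_additive.

Let sigma_finite_step : sigma_finite setT lebesgue_rV_step.
Proof.
have /sigma_finiteP[F [TF ndF Foo]] := sigma_finiteT (@lebesgue_measure R).
have /sigma_finiteP[G [TG ndG Goo]] := sigma_finiteT m.
exists (fun k => @rV_split R n @^-1` (F k `*` G k)).
  apply/seteqP; split=> // v _.
  have [i _ Fi] : (\bigcup_i F i) (rV_split v).1 by rewrite -TF.
  have [j _ Gj] : (\bigcup_i G i) (rV_split v).2 by rewrite -TG.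
  exists (maxn i j) => //; split.
    by move: Fi; exact/subsetPset/ndF/leq_maxl.
  by move: Gj; exact/subsetPset/ndG/leq_maxr.
move=> k; have [mF Fk] := Foo k; have [mG Gk] := Goo k; split.
  by rewrite -[X in measurable X]setTI; apply: measurable_rV_split => //;
    exact: measurableX.
rewrite /lebesgue_rV_step /pushforward -comp_preimage.
rewrite (_ : _ \o _ = id); last by apply/funext => p /=; rewrite rV_consK.
by rewrite preimage_id product_measure1E// lte_mul_pinfty// ge0_fin_numE.
Qed.

HB.instance Definition _ := Measure_isSigmaFinite.Build _ _ _
  lebesgue_rV_step sigma_finite_step.

End step.

(* Lebesgue measure on R^n, as the n-fold product of the one on R. *)
Fixpoint lebesgue_rV (n : nat) : {sigma_finite_measure set 'rV[R]_n -> \bar R} :=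
  match n with
  | 0 => [the {sigma_finite_measure set _ -> \bar R} of \d_(0 : 'rV[R]_0)]
  | n.+1 => [the {sigma_finite_measure set _ -> \bar R} of
      lebesgue_rV_step (lebesgue_rV n)]
  end.

Lemma lebesgue_rV_box n (a b : 'rV[R]_n) :
  (forall i, a ord0 i <= b ord0 i) ->
  lebesgue_rV n [set v | forall i, v ord0 i \in `]a ord0 i, b ord0 i]]
  = (\prod_(i < n) (b ord0 i - a ord0 i))%:E.
Proof.
elim: n a b => [|n IH] a b ab.
  rewrite big_ord0 /= diracE mem_set//; by case.
rewrite /= /lebesgue_rV_step /pushforward.
pose a' := (rV_split a).2; pose b' := (rV_split b).2.
have a'E i : a' ord0 i = a ord0 (lift ord0 i) by rewrite mxE.
have b'E i : b' ord0 i = b ord0 (lift ord0 i) by rewrite mxE.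
transitivity ((@lebesgue_measure R \x lebesgue_rV n)%E
    ([set` `]a ord0 ord0, b ord0 ord0]] `*`
     [set v : 'rV[R]_n | forall i, v ord0 i \in `]a' ord0 i, b' ord0 i]])); last first.
  rewrite product_measure1E//; last first.
    rewrite (_ : mkset _ = \bigcap_(i in [set: 'I_n])
      ((fun v : 'rV[R]_n => v ord0 i) @^-1` [set` `]a' ord0 i, b' ord0 i]])).
      rewrite -[X in measurable X]setCK setC_bigcap; apply: measurableC.
      apply: fin_bigcup_measurable => [|i _]; first exact: finite_finset.
      apply: measurableC; rewrite -[X in measurable X]setTI.
      by apply: measurable_coord => //; exact: measurable_itv.
    by apply/seteqP; split=> [v vab i _|v vab i]; exact: vab.
  rewrite IH; last by move=> i; rewrite a'E b'E.
  rewrite /= lebesgue_measure_itv/= lte_fin big_ord_recl EFinM.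
  congr (_ * _)%E; last by under eq_bigr do rewrite a'E b'E.
  case: ltP => // ba; rewrite (_ : b _ _ = a ord0 ord0) ?subrr//.
  by apply/eqP; rewrite eq_le ba ab.
congr (_ _); apply/seteqP; split=> [p pab|p [p1 p2] i] /=.
  split; first by have := pab ord0; rewrite rV_cons0.
  by move=> i; have := pab (lift ord0 i); rewrite rV_consS a'E b'E.
have [j ->|->] := unliftP ord0 i; last by rewrite rV_cons0.
by have := p2 j; rewrite rV_consS a'E b'E.
Qed.

End lebesgue_rV.

(* Euclidean norm; the library norm on matrices is the sup norm, which gives
   the same topology. *)
Definition enorm (R : realType) (d : nat) (x : 'rV[R]_d) : R :=
  Num.sqrt (\sum_(i < d) x ord0 i ^+ 2).

Definition eball (R : realType) (d : nat) (x : 'rV[R]_d) (r : R) :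
  set 'rV[R]_d := [set y | enorm (y - x) < r].

(* The filter |x| --> +oo on R^d. *)
Definition enorm_infty (R : realType) (d : nat) : set_system 'rV[R]_d :=
  filter_from [set: R] (fun M => [set x | M < enorm x]).

Global Instance enorm_infty_filter (R : realType) (d : nat) :
  Filter (@enorm_infty R d).
Proof.
apply: filter_from_filter; first by exists 0.
move=> M N _ _; exists (Num.max M N) => // x /=.
by rewrite gt_max => /andP.
Qed.

Section potentials.
Context (R : realType) (d : nat).
Implicit Types x : 'rV[R]_d.

(* r^p / p for r > 0, read as log r when p = 0. *)
Definition power_term (p r : R) : R := if p == 0 then ln r else r `^ p / p.

(* The value at the origin is the limit of W at 0. *)
Definition power_law (a b : R) x : \bar R :=
  if x == 0 then if 0 < b then 0%E else +oo%E
  else (power_term a (enorm x) - power_term b (enorm x))%:E.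

Definition morse (CA CR lA lR : R) x : \bar R :=
  (CR * expR (- (enorm x / lR)) - CA * expR (- (enorm x / lA)))%:E.

End potentials.

Section hypotheses.
Context (R : realType) (d : nat).
Implicit Types W : 'rV[R]_d -> \bar R.

Local Open Scope ereal_scope.

Definition interaction_energy W (rho : probability 'rV[R]_d R) : \bar R :=
  (2^-1)%:E * \int[rho \x rho]_z W (z.1 - z.2)%R.

Definition bounded_below W :=
  exists2 Wmin : R, (Wmin < 0)%R & forall x, Wmin%:E <= W x.

Definition locally_integrable_rV W :=
  forall x (r : R), (0 < r)%R -> (lebesgue_rV R d).-integrable (eball x r) W.

Definition even_potential W := forall x, W x = W (- x)%R.

Definition energy_below_limit W :=
  exists Winf : \bar R, W x @[x --> @enorm_infty R d] --> Winf /\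
    exists mu : probability 'rV[R]_d R,
      interaction_energy W mu < (2^-1)%:E * Winf.

Definition coordinatewise_increasing W :=
  exists2 R6 : R, (0 < R6)%R & forall (k : 'I_d) (x y : 'rV[R]_d),
    (forall i, i != k -> x ord0 i = y ord0 i) ->
    (R6 <= x ord0 k)%R -> (x ord0 k < y ord0 k)%R -> W x < W y.

Record potential_hypotheses W : Prop := PotentialHypotheses {
  potential_bounded_below : bounded_below W;
  potential_locally_integrable : locally_integrable_rV W;
  potential_even : even_potential W;
  potential_limit : energy_below_limit W;
  potential_lsc : lower_semicontinuous W;
  potential_increasing : coordinatewise_increasing W
}.

End hypotheses.

(* Main.v *)
From HB Require Import structures.
Require Import Defs.
From mathcomp Require Import all_boot all_order all_algebra.
From mathcomp Require Import all_classical all_reals all_analysis.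
From mathcomp Require Import measurable_realfun ring lra.

Import Order.TTheory GRing.Theory Num.Theory.
Import numFieldNormedType.Exports.
Local Open Scope classical_set_scope.
Local Open Scope ring_scope.

(** Both potentials are radial, [W x = w (enorm x)], so that evenness, the limit
    at infinity, lower semicontinuity and coordinatewise monotonicity are
    statements about the profile [w] on the half-line.

    For the power law, [w = power_diff a b] has derivative
    [r ^ (a - 1) - r ^ (b - 1)], hence increases strictly on [r >= 1], and
    inversion [r -> r^-1] exchanges the exponents [a, b] with [- b, - a]
    ([power_diffV]).  So [w] is minimal at [1], which gives the lower bound, and
    its behaviour at [0] is read off its behaviour at infinity.  The same
    minimality says that [power_term] grows with its exponent up to an additive
    constant, which bounds [w] near [0] by a multiple of [r ^ (- p)] for some
    [0 < p < d].

    Everything about integrals rests on the kernel [riesz p], that is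
    [|x| ^ (- p)] with value [+oo] at [0].  As [|x_i| <= |x|], it is at most the
    product over the coordinates of [|x_i| ^ (- p / d)], and [p / d < 1]: by
    Tonelli it is locally integrable ([integral_riesz_pow_le]), and its double
    integral [riesz_energy p] over the unit cube is finite
    ([riesz_energy_fin_num]).  Local integrability of [W] follows.

    The competitor in [energy_below_limit] is the uniform law on a cube of side [L],
    whose energy is the double integral over the unit cube of
    [W (L *: (x - y))].
    - If [a >= 0] the limit of [W] is [+oo] and [L = 1] has finite energy.
    - If [a < 0] the limit is [0] and the energy is at most
      [C L ^ b - c L ^ a] with [c > 0], which is negative for large [L] because
      [b < a].
    - For the Morse potential the limit is [0] and the energy is, up to the
      factor [1 / 2], [CR F (L / lR) - CA F (L / lA)], where [F s] is the double
      integral of [exp (- s |x - y|)].  Were it nonnegative for every [L], then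
      with [q = lA / lR] one would get [F (q ^ n) >= (CA / CR) ^ n F 1]; but
      [F s = O (s ^ (- p))] for each [p < d], and [q ^ p > CR / CA] for [p] close
      to [d] ([exp_energy_scaling]). *)

(** * The kernel [r ^ (- p)] on the half-line *)

Lemma gt1_ltr_powR (R : realType) (a x y : R) : 1 < a -> x < y ->
  a `^ x < a `^ y.
Proof.
move=> a1 xy; rewrite /powR gt_eqF ?(lt_trans ltr01)//.
by rewrite ltr_expR ltr_pM2r// ln_gt0.
Qed.

Section riesz_kernel.
Context {R : realType}.
Implicit Types p c t : R.

(** The value [+oo] at [0] makes pointwise bounds such as
    [riesz_enorm_le_prod] hold everywhere, not only off the diagonal. *)
Definition riesz p t : \bar R := if t == 0 then +oo%E else (t `^ (- p))%:E.

Lemma riesz_ge0 p t : (0 <= riesz p t)%E.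
Proof. by rewrite /riesz; case: ifPn => // _; rewrite lee_fin powR_ge0. Qed.

Lemma riesz_antitone p s t : 0 <= p -> 0 <= s -> s <= t ->
  (riesz p t <= riesz p s)%E.
Proof.
move=> p0 s0 st; rewrite /riesz; have [_|sn0] := eqVneq s 0; first exact: leey.
have s_gt0 : 0 < s by rewrite lt_neqAle eq_sym sn0.
have t_gt0 : 0 < t := lt_le_trans s_gt0 st.
rewrite gt_eqF// lee_fin !powRN lef_pV2 ?posrE ?powR_gt0//.
by rewrite ge0_ler_powR ?nnegrE ?(ltW t_gt0).
Qed.

Lemma measurable_riesz p : measurable_fun setT (riesz p).
Proof.
rewrite /riesz; apply: measurable_fun_ifT => //.
  by apply: measurable_fun_eqr; [exact: measurable_id|exact: measurable_cst].
by apply/measurable_EFinP; exact: measurable_powR.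
Qed.

(** Splitting the exponent evenly turns a kernel of order [p < n] into a product
    of kernels of order less than [1], one for each coordinate of the space. *)
Lemma riesz_prod (n : nat) p t : (0 < n)%N -> 0 <= t ->
  riesz p t = (\prod_(i < n) riesz (p / n%:R) t)%E.
Proof.
move=> n0 t0; rewrite /riesz; have [_|tn0] := eqVneq t 0.
  by case: n n0 => // n _; elim: n => [|n IH];
    rewrite big_ord_recl ?big_ord0 ?mule1// -IH mulyy.
rewrite prodEFin prodr_const card_ord.
rewrite -powR_mulrn ?powR_ge0// -powRrM; congr ((t `^ _)%:E).
by rewrite -mulNr divfK// pnatr_eq0 -lt0n.
Qed.

(** If [2 ^ (- k - 1) <= |u| < 2 ^ (- k)] then [|u| ^ (- c)] is at most the term
    of index [k].  A series of indicators of balls is easy to integrate whatever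
    the pole is, and at [u = 0] it diverges, as it should. *)
Lemma riesz_dyadic c (u : R) : 0 < c ->
  (riesz c `|u| <= 1 + \sum_(0 <= k <oo)
     ((2 `^ c) ^+ k.+1)%:E * (\1_(ball (0 : R) (2 ^- k)) u)%:E)%E.
Proof.
move=> c0; set v := fun k : nat => (((2 `^ c) ^+ k.+1)%:E *
  (\1_(ball (0 : R) (2 ^- k)) u)%:E)%E.
have v0 k : (0 <= v k)%E.
  by rewrite /v mule_ge0// ?lee_fin// exprn_ge0// powR_ge0.
have p1 : 1 <= 2 `^ c :> R by rewrite -[leLHS](powRr0 2) ler_powR ?ler1n// ltW.
rewrite /riesz; have [u0|un0] := eqVneq `|u| 0.
  have -> : (\sum_(0 <= k <oo) v k = +oo)%E; last by rewrite addey.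
  apply/eqyP => A A0; have [n An] : exists n : nat, A <= n%:R.
    by exists (Num.truncn A).+1; rewrite ltW// truncnS_gt.
  apply: le_trans (nneseries_lim_ge n (fun k _ _ => v0 k)).
  apply: (@le_trans _ _ (\sum_(0 <= k < n) 1)%E).
    by rewrite sumEFin lee_fin sumr_const_nat subn0.
  apply: lee_sum => k _; rewrite /v indicE mem_set ?mule1 ?lee_fin ?exprn_ege1//.
  by rewrite /ball/= sub0r normrN u0 invr_gt0 exprn_gt0.
have u_gt0 : 0 < `|u| by rewrite lt_neqAle eq_sym un0 normr_ge0.
have [u1|u1] := leP 1 `|u|.
  rewrite -[leLHS]adde0 leeD ?nneseries_ge0// lee_fin.
  by rewrite powRN invf_le1 ?powR_gt0// -[leLHS](powRr0 `|u|) ler_powR// ltW.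
have ex : exists k : nat, 2 ^- k <= `|u|.
  have [k ku] : exists k : nat, `|u|^-1 <= k%:R.
    by exists (Num.truncn `|u|^-1).+1; rewrite ltW// truncnS_gt.
  exists k; rewrite -[leRHS]invrK lef_pV2 ?posrE ?invr_gt0 ?exprn_gt0//.
  by rewrite (le_trans ku)// -natrX ler_nat ltnW// ltn_expl.
have [[|k] ku kmin] := ex_minnP ex.
  by move: ku; rewrite expr0 invr1 leNgt u1.
have uk : `|u| < 2 ^- k.
  by rewrite ltNge; apply/negP => /kmin; rewrite ltnn.
apply: (@le_trans _ _ (v k)); last first.
  rewrite -[leLHS]add0e leeD ?lee_fin//.
  apply: le_trans (nneseries_lim_ge k.+1 (fun i _ _ => v0 i)).
  by rewrite big_nat_recr//= leeDr// sume_ge0.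
rewrite /v indicE mem_set ?mule1 ?lee_fin; last first.
  by rewrite /ball/= sub0r normrN.
rewrite powRN -[leLHS]mul1r ler_pdivrMr ?powR_gt0//.
rewrite -powR_mulrn ?powR_ge0// powRAC powR_mulrn//.
rewrite -powRM ?exprn_ge0// -[leLHS](powRr0 (2 ^+ k.+1 * `|u|)).
apply: ler_powR; last exact: ltW.
by rewrite mulrC -ler_pdivrMr ?exprn_gt0// mul1r.
Qed.

(** The [k]-th dyadic layer contributes a constant times [2 ^ (k (c - 1))], a
    convergent geometric series as [c < 1].  Uniformity in the pole [s] lets a
    double integral over a cube be bounded by one-dimensional integrals. *)
Lemma integral_riesz_le c : 0 < c < 1 ->
  exists2 C : R, 0 <= C & forall (D : set R) (s : R), measurable D ->
    (\int[lebesgue_measure]_(t in D) riesz c `|s - t|%R <=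
     lebesgue_measure D + C%:E)%E.
Proof.
move=> /andP[c0 c1].
set q : R := 2 `^ c / 2.
have q0 : 0 < q by rewrite divr_gt0// powR_gt0.
have q1 : q < 1.
  by rewrite ltr_pdivrMr// mul1r -[ltRHS]powRr1// gt1_ltr_powR// ltr1n.
(* the sum of the series [2 ^ (c (k + 1)) * (2 * 2 ^ (- k))] over [k] *)
exists (2 `^ c * 2 * (1 - q)^-1).
  by rewrite !mulr_ge0// ?powR_ge0// invr_ge0 subr_ge0 ltW.
move=> D s mD.
set v := fun (k : nat) (t : R) => (((2 `^ c) ^+ k.+1)%:E *
  (\1_(ball (0 : R) (2 ^- k)) (s - t))%:E)%E.
have v0 k t : (0 <= v k t)%E.
  by rewrite /v mule_ge0// ?lee_fin// exprn_ge0// powR_ge0.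
have msub : measurable_fun setT (fun t => s - t) by exact: measurable_funB.
have mind k : measurable_fun setT (\1_(ball (0 : R) (2 ^- k)) : R -> R).
  by apply: measurable_indic; exact: measurable_ball.
have mv k : measurable_fun D (v k).
  apply: measurable_funTS; apply: measurable_funeM; apply/measurable_EFinP.
  exact: (measurableT_comp (mind k) msub).
have mS : measurable_fun D (fun t => \sum_(0 <= k <oo) v k t)%E.
  apply: (@ge0_emeasurable_sum _ _ _ _ v xpredT) => [k t _ _|k _].
    exact: v0.
  exact: mv.
have mR : measurable_fun D (fun t => riesz c `|s - t|).
  apply: measurable_funTS.
  apply: (measurableT_comp (measurable_riesz c)).
  exact: (measurableT_comp (@normr_measurable _ _)).
apply: (@le_trans _ _
  (\int[lebesgue_measure]_(t in D) (1 + \sum_(0 <= k <oo) v k t))%E).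
  apply: ge0_le_integral => //.
  - by move=> t _; exact: riesz_ge0.
  - by apply: emeasurable_funD => //; exact: mS.
  - by move=> t _; exact: riesz_dyadic.
rewrite ge0_integralD//; last by move=> t _; exact: nneseries_ge0.
rewrite integral_cst// mul1e leeD2l// integral_nneseries//.
have vk k : (\int[lebesgue_measure]_(t in D) v k t <=
    (geometric (2 `^ c * 2) q k)%:E)%E.
  rewrite ge0_integralZl//; last first.
    apply/measurable_EFinP/measurable_funTS.
    exact: (measurableT_comp (mind k) msub).
  rewrite [X in (_ * X)%E](_ : _ =
      \int[lebesgue_measure]_(t in D) (\1_(ball s (2 ^- k)) t)%:E)%E; last first.
    apply: eq_integral => t _; rewrite !indicE; congr ((_ : bool)%:R%:E).
    by apply/idP/idP; rewrite !inE /ball/= sub0r normrN.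
  rewrite integral_indic//; last exact: measurable_ball.
  apply: (@le_trans _ _ (((2 `^ c) ^+ k.+1)%:E *
      lebesgue_measure (ball s (2 ^- k : R))))%E.
    apply: lee_wpmul2l; first by rewrite lee_fin exprn_ge0// powR_ge0.
    apply: le_measure => //; rewrite ?inE; last exact: measurable_ball.
    by apply: measurableI => //; exact: measurable_ball.
  rewrite lebesgue_measure_ball ?invr_ge0 ?exprn_ge0// -EFinM lee_fin.
  rewrite /geometric/= /q expr_div_n exprS -mulr_natr le_eqVlt.
  by apply/orP; left; apply/eqP; field; rewrite expf_neq0.
apply: (@le_trans _ _ (\sum_(0 <= k <oo) (geometric (2 `^ c * 2) q k)%:E)%E).
  apply: lee_nneseries => [k _ _|k _]; last exact: vk.
  by apply: integral_ge0.
apply: lime_le.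
  apply: is_cvg_nneseries => k _ _; rewrite lee_fin.
  by rewrite /geometric/= !mulr_ge0 ?powR_ge0 ?exprn_ge0// ltW.
apply: nearW => n; rewrite sumEFin lee_fin.
apply: geometric_le_lim => //.
by rewrite ger0_norm// ltW.
Qed.
End riesz_kernel.

(** * The Euclidean norm *)

Section enorm_facts.
Context {R : realType} {d : nat}.
Implicit Types x y : 'rV[R]_d.

Lemma enorm_ge0 x : 0 <= enorm x.
Proof. exact: sqrtr_ge0. Qed.

Lemma le_coord_enorm x i : `|x ord0 i| <= enorm x.
Proof.
rewrite -sqrtr_sqr ler_wsqrtr// (bigD1 i)//= lerDl.
by rewrite sumr_ge0// => j _; exact: sqr_ge0.
Qed.

Lemma enorm0 : enorm (0 : 'rV[R]_d) = 0.
Proof. by rewrite /enorm big1 ?sqrtr0// => i _; rewrite mxE expr0n. Qed.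

Lemma enorm_eq0 x : (enorm x == 0) = (x == 0).
Proof.
apply/eqP/eqP => [x0|->]; last exact: enorm0.
apply/rowP => i; rewrite mxE; apply/eqP; rewrite -normr_le0 -x0.
exact: le_coord_enorm.
Qed.

Lemma enormN x : enorm (- x) = enorm x.
Proof. by rewrite /enorm; under eq_bigr do rewrite mxE sqrrN. Qed.

Lemma enormZ (a : R) x : 0 <= a -> enorm (a *: x) = a * enorm x.
Proof.
move=> a0; rewrite /enorm.
under eq_bigr do rewrite mxE exprMn.
by rewrite -mulr_sumr sqrtrM ?sqr_ge0// sqrtr_sqr ger0_norm.
Qed.

Lemma enorm_le_box (M : R) x : (forall i, `|x ord0 i| <= M) ->
  enorm x <= Num.sqrt d%:R * M.
Proof.
move=> xM; case: d x xM => [|n] x xM.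
  by rewrite /enorm big_ord0 sqrtr0 mul0r.
have M0 : 0 <= M := le_trans (normr_ge0 _) (xM ord0).
rewrite -[X in _ * X](ger0_norm M0) -sqrtr_sqr -sqrtrM// ler_wsqrtr//.
rewrite -[X in X%:R * _]card_ord mulr_natl -sumr_const ler_sum// => i _.
by rewrite -real_normK ?num_real// lerXn2r ?nnegrE.
Qed.

Lemma continuous_enorm : continuous (@enorm R d).
Proof.
move=> x; apply: continuous_comp; last exact: sqrt_continuous.
apply: (@continuous_big _ _ _ _ _ _ _ _
  (fun i (y : 'rV[R]_d) => y ord0 i ^+ 2)) => [|i _ y].
  exact: add_continuous.
apply: (@continuous_comp _ _ _ (fun y : 'rV[R]_d => y ord0 i) (fun t => t ^+ 2)).
  exact: coord_continuous.
exact: exprn_continuous.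
Qed.

Lemma measurable_enorm : measurable_fun setT (@enorm R d).
Proof.
apply: (measurability _ (RGenOpens.measurableE R)) => _ [_ [a [b ->] <-]].
rewrite setTI; apply: open_measurable_rV.
apply: open_comp; last exact: interval_open.
by move=> v _; exact: continuous_enorm.
Qed.

End enorm_facts.

(** * Integrals of the kernel over boxes *)

Lemma lee_prod (R : realDomainType) I (s : seq I) (P : pred I)
    (f g : I -> \bar R) :
  (forall i, P i -> (0 <= f i <= g i)%E) ->
  (\prod_(i <- s | P i) f i <= \prod_(i <- s | P i) g i)%E.
Proof.
move=> fg.
suff /andP[] : (0 <= \prod_(i <- s | P i) f i <= \prod_(i <- s | P i) g i)%E by [].
elim/big_ind2 : _ => [|a b c e /andP[a0 ab] /andP[c0 ce]|//].
  by rewrite lee_fin ler01 lexx.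
by rewrite mule_ge0// lee_pmul.
Qed.

Lemma emeasurable_prod d (T : measurableType d) (R : realType) (D : set T)
    I (s : seq I) (h : I -> T -> \bar R) :
  (forall i, measurable_fun D (h i)) ->
  measurable_fun D (fun x => \prod_(i <- s) h i x)%E.
Proof.
move=> mh; elim: s => [|i s IH].
  by under eq_fun do rewrite big_nil; exact: measurable_cst.
by under eq_fun do rewrite big_cons; exact: emeasurable_funM.
Qed.

(** Each factor of [riesz_prod] is antitone and [|x_i| <= |x|]. *)
Lemma riesz_enorm_le_prod (R : realType) (d : nat) (p : R) (x : 'rV[R]_d) :
  (0 < d)%N -> 0 <= p ->
  (riesz p (enorm x) <= \prod_(i < d) riesz (p / d%:R) `|x ord0 i|%R)%E.
Proof.
move=> d0 p0; rewrite (@riesz_prod _ d)// ?enorm_ge0//.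
apply: lee_prod => i _; rewrite riesz_ge0/=.
by apply: riesz_antitone; rewrite ?divr_ge0// le_coord_enorm.
Qed.

(** Lebesgue measure on [R^(n+1)] is the image of the product of those on [R] and
    [R^n], so Tonelli applies by induction. *)
Lemma integral_lebesgue_rV_prod (R : realType) n (f : 'I_n -> R -> \bar R) :
  (forall i, measurable_fun setT (f i)) -> (forall i t, (0 <= f i t)%E) ->
  (\int[lebesgue_rV R n]_x \prod_(i < n) f i (x ord0 i) =
   \prod_(i < n) \int[lebesgue_measure]_t f i t)%E.
Proof.
elim: n f => [|n IH] f mf f0.
  under eq_integral do rewrite big_ord0.
  by rewrite big_ord0 integral_cst//= mul1e diracT.
pose P (x : 'rV[R]_n.+1) := (\prod_(i < n.+1) f i (x ord0 i))%E.
pose Q (x : 'rV[R]_n) := (\prod_(i < n) f (lift ord0 i) (x ord0 i))%E.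
have mP : measurable_fun setT P.
  apply: emeasurable_prod => i.
  exact: (measurableT_comp (mf i) (@measurable_coord R _ i)).
have mQ : measurable_fun setT Q.
  apply: emeasurable_prod => i.
  exact: (measurableT_comp (mf _) (@measurable_coord R _ i)).
have P0 x : (0 <= P x)%E by apply: prode_ge0.
have Q0 x : (0 <= Q x)%E by apply: prode_ge0.
transitivity (\int[pushforward (@lebesgue_measure R \x lebesgue_rV R n)%E
    (@rV_cons R n)]_x P x)%E.
  by apply: eq_measure_integral => //; exact: measurable_rV_cons.
rewrite ge0_integral_pushforward//; last exact: measurable_rV_cons.
rewrite preimage_setT fubini_tonelli1//=; last first.
  exact: (measurableT_comp mP (@measurable_rV_cons R n)).
rewrite /fubini_F /=.
transitivity (\int[lebesgue_measure]_t (f ord0 t * \int[lebesgue_rV R n]_x Q x))%E.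
  apply: eq_integral => t _; rewrite -ge0_integralZl//.
  apply: eq_integral => x _; rewrite /P big_ord_recl rV_cons0 /=.
  by congr (_ * _)%E; apply: eq_bigr => i _; rewrite rV_consS.
rewrite ge0_integralZr//; [|exact: mf|by apply: integral_ge0].
by rewrite /Q (IH (fun i => f (lift ord0 i)))// big_ord_recl.
Qed.

Section boxes.
Context {R : realType} {d : nat}.
Implicit Types (D : set R) (x y : 'rV[R]_d).

Definition rV_pow D : set 'rV[R]_d := [set v | forall i, D (v ord0 i)].

Lemma measurable_rV_pow D : measurable D -> measurable (rV_pow D).
Proof.
move=> mD; rewrite (_ : rV_pow D = ~` (\bigcup_(i in [set: 'I_d])
    ((fun v : 'rV[R]_d => v ord0 i) @^-1` (~` D)))).
  apply: measurableC; apply: fin_bigcup_measurable => [|i _].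
    exact: finite_finset.
  rewrite -[X in measurable X]setTI.
  by apply: measurable_coord => //; exact: measurableC.
apply/seteqP; split=> [v Dv [i _]|v Dv i]; first exact.
by apply: contrapT => Dvi; apply: Dv; exists i.
Qed.

Lemma integral_rV_pow_prod D (f : 'I_d -> R -> \bar R) : measurable D ->
  (forall i, measurable_fun setT (f i)) -> (forall i t, (0 <= f i t)%E) ->
  (\int[lebesgue_rV R d]_(x in rV_pow D) \prod_(i < d) f i (x ord0 i) =
   \prod_(i < d) \int[lebesgue_measure]_(t in D) f i t)%E.
Proof.
move=> mD mf f0; rewrite integral_mkcond.
under [RHS]eq_bigr do rewrite integral_mkcond.
rewrite -integral_lebesgue_rV_prod; last 2 first.
- move=> i; apply/(measurable_restrictT _ _).1 => //.
  exact: measurable_funTS.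
- by move=> i t; rewrite patchE; case: ifPn.
apply: eq_integral => x _; rewrite patchE; case: ifPn => [|/negP]; rewrite inE.
  by move=> xD; apply: eq_bigr => i _; rewrite patchE mem_set.
move=> /existsNP[i xDi]; rewrite (bigD1 i)//= patchE ifN ?mul0e//.
by rewrite notin_setE.
Qed.

Lemma integral_riesz_pow_le (p : R) : 0 < p < d%:R ->
  exists2 C : R, 0 <= C & forall D y, measurable D ->
    (\int[lebesgue_rV R d]_(x in rV_pow D) riesz p (enorm (y - x)%R) <=
     \prod_(i < d) (lebesgue_measure D + C%:E))%E.
Proof.
move=> /andP[p0 pd]; have d0 : 0 < d%:R :> R := lt_trans p0 pd.
have [|C C0 HC] := @integral_riesz_le R (p / d%:R).
  by rewrite divr_gt0//= ltr_pdivrMr// mul1r.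
exists C => // D y mD.
(* the pole is the fixed point [y], coordinate by coordinate *)
pose f (i : 'I_d) (t : R) := riesz (p / d%:R) `|y ord0 i - t|.
have mf i : measurable_fun setT (f i).
  apply: (measurableT_comp (measurable_riesz _)).
  apply: (measurableT_comp (@normr_measurable _ _)).
  exact: measurable_funB.
have f0 i t : (0 <= f i t)%E by exact: riesz_ge0.
apply: (@le_trans _ _ (\prod_(i < d) \int[lebesgue_measure]_(t in D) f i t)%E); last first.
  by apply: lee_prod => i _; rewrite integral_ge0//= HC.
rewrite -integral_rV_pow_prod//; apply: ge0_le_integral => //.
- exact: measurable_rV_pow.
- by move=> x _; exact: riesz_ge0.
- apply: measurable_funTS; apply: (measurableT_comp (measurable_riesz _)).
  apply: (measurableT_comp measurable_enorm).
  apply: measurable_fun_rVP => i; under eq_fun do rewrite !mxE.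
  by apply: measurable_funB => //; exact: measurable_coord.
- apply: measurable_funTS; apply: emeasurable_prod => i.
  exact: (measurableT_comp (mf i) (@measurable_coord R _ i)).
move=> x _; apply: le_trans.
  by apply: riesz_enorm_le_prod; [rewrite -(ltr0n R)|exact: ltW].
by apply: lee_prod => i _; rewrite riesz_ge0 !mxE lexx.
Qed.

End boxes.

(** * The uniform law on a cube *)

Lemma ge0_integral_mrestr d (T : measurableType d) (R : realType)
    (m : {measure set T -> \bar R}) (D : set T) (mD : measurable D)
    (f : T -> \bar R) :
  measurable_fun setT f -> (forall x, 0 <= f x)%E ->
  (\int[mrestr m mD]_x f x = \int[m]_(x in D) f x)%E.
Proof.
move=> mf f0.
rewrite (@ge0_negligible_integral _ _ _ _ setT (~` D))//.
- rewrite setTD setCK; apply: eq_measure_integral => A mA AD.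
  by rewrite /= /mrestr setIidl.
- exact: measurableC.
- by rewrite /= /mrestr setICl measure0.
Qed.

(** Positive and negative parts compare separately, and subtraction of extended
    reals is monotone even when it involves infinities; so a potential that is
    not known to be integrable can be compared with an integrable majorant. *)
Lemma ae_le_integralT d (T : measurableType d) (R : realType)
    (m : {measure set T -> \bar R}) (f g : T -> \bar R) :
  measurable_fun setT f -> measurable_fun setT g ->
  {ae m, forall x, (f x <= g x)%E} ->
  (\int[m]_x f x <= \int[m]_x g x)%E.
Proof.
move=> mf mg fg; rewrite [leLHS]integralE [leRHS]integralE.
apply: leeB; apply: ae_ge0_le_integral => //.
- exact: measurable_funepos.
- exact: measurable_funepos.
- apply: filterS fg => x fgx _.
  by apply: (@funepos_le _ _ [set x] f g); rewrite ?inE// => y /[!inE] ->.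
- exact: measurable_funeneg.
- exact: measurable_funeneg.
- apply: filterS fg => x fgx _.
  by apply: (@funeneg_le _ _ [set x] f g); rewrite ?inE// => y /[!inE] ->.
Qed.

Section cube.
Context (R : realType) (d : nat).

(** Half-open, as the boxes of [lebesgue_rV_box] *)
Definition unit_cube : set 'rV[R]_d := rV_pow [set` `]0, 1]].

Lemma measurable_unit_cube : measurable unit_cube.
Proof. by apply: measurable_rV_pow; exact: measurable_itv. Qed.

Lemma unit_cube_measure1 : lebesgue_rV R d unit_cube = 1%E.
Proof.
rewrite (_ : unit_cube = [set v | forall i, v ord0 i \in
    `](0 : 'rV[R]_d) ord0 i, (const_mx 1 : 'rV[R]_d) ord0 i]]); last first.
  by apply/seteqP; split=> v v01 i; have := v01 i; rewrite !mxE.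
rewrite lebesgue_rV_box => [|i]; last by rewrite !mxE.
by rewrite big1// => i _; rewrite !mxE subr0.
Qed.

Definition cube_prob : set 'rV[R]_d -> \bar R :=
  mrestr (lebesgue_rV R d) measurable_unit_cube.

HB.instance Definition _ := Measure.on cube_prob.

Lemma cube_probT : cube_prob setT = 1%E.
Proof. by rewrite /cube_prob /mrestr setTI unit_cube_measure1. Qed.

HB.instance Definition _ := Measure_isProbability.Build _ _ _ cube_prob cube_probT.

Definition dilate (L : R) (x : 'rV[R]_d) : 'rV[R]_d := L *: x.

Lemma measurable_dilate L : measurable_fun setT (dilate L).
Proof.
apply: measurable_fun_rVP => i; under eq_fun do rewrite !mxE.
by apply: measurable_funM => //; exact: measurable_coord.
Qed.

HB.instance Definition _ L :=
  isMeasurableFun.Build _ _ _ _ (dilate L) (measurable_dilate L).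

(** Defined as an image measure, so that energies at scale [L] become integrals
    over the unit cube of the rescaled potential. *)
Definition cube_probL (L : R) : probability 'rV[R]_d R :=
  [the probability _ _ of distribution cube_prob (dilate L)].

End cube.

Section cube_pairs.
Context {R : realType} {d : nat}.
Local Notation mu := (cube_prob R d).

(** The product of the two image measures and the image of the product measure
    agree on rectangles, hence everywhere.  As [f] is only measurable, its
    positive and negative parts are transferred separately. *)
Lemma integral_dilate (L : R) (f : 'rV[R]_d * 'rV[R]_d -> \bar R) :
  measurable_fun setT f ->
  (\int[cube_probL R d L \x cube_probL R d L]_z f z =
   \int[mu \x mu]_z f (L *: z.1, L *: z.2)%R)%E.
Proof.
move=> mf.
pose phi (z : 'rV[R]_d * 'rV[R]_d) := (dilate R d L z.1, dilate R d L z.2).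
have mphi : measurable_fun setT phi.
  apply: measurable_fun_pair.
    exact: (measurableT_comp (measurable_dilate R d L) measurable_fst).
  exact: (measurableT_comp (measurable_dilate R d L) measurable_snd).
have transfer g : measurable_fun setT g -> (forall z, 0 <= g z)%E ->
    (\int[cube_probL R d L \x cube_probL R d L]_z g z =
     \int[mu \x mu]_z g (phi z))%E.
  move=> mg g0; rewrite -[RHS](@ge0_integral_pushforward _ _ _ _ _ _ mphi _ setT)//.
  apply: eq_measure_integral => // A mA _.
  apply: product_measure_unique => // B C mB mC.
  rewrite /= /pushforward (_ : phi @^-1` _ =
    (dilate R d L @^-1` B) `*` (dilate R d L @^-1` C))//.
  rewrite product_measure1E// -[X in measurable X]setTI;
    exact: measurable_dilate.
rewrite [LHS]integralE [RHS]integralE; rewrite !transfer//.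
- congr (_ - _)%E; apply: eq_integral => z _.
    by rewrite !funeposE.
  by rewrite !funenegE.
- exact: measurable_funeneg.
- exact: measurable_funepos.
Qed.

Lemma ae_unit_cube2 :
  {ae (mu \x mu)%E, forall z, unit_cube R d z.1 /\ unit_cube R d z.2}.
Proof.
have mC := measurable_unit_cube R d.
exists (~` (unit_cube R d `*` unit_cube R d)); split => //.
  by apply: measurableC; exact: measurableX.
have muC : mu (unit_cube R d) = 1%E.
  by rewrite /cube_prob /mrestr setIid unit_cube_measure1.
have mumuC : (mu \x mu)%E (unit_cube R d `*` unit_cube R d) = 1%E.
  by rewrite product_measure1E// -[RHS]mule1; congr (_ * _)%E; exact: muC.
rewrite probability_setC; last exact: measurableX.
by rewrite [X in (1 - X)%E](mumuC : _ = 1%E) subee.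
Qed.

Lemma le_integral_cube2 (f g : 'rV[R]_d * 'rV[R]_d -> \bar R) :
  measurable_fun setT f -> measurable_fun setT g ->
  (forall x y, unit_cube R d x -> unit_cube R d y -> (f (x, y) <= g (x, y))%E) ->
  (\int[mu \x mu]_z f z <= \int[mu \x mu]_z g z)%E.
Proof.
move=> mf mg fg; apply: ae_le_integralT => //.
by apply: filterS ae_unit_cube2 => -[x y] /= [xC yC]; exact: fg.
Qed.

Lemma measurable_diff_pair (L : R) :
  measurable_fun setT (fun z : 'rV[R]_d * 'rV[R]_d => L *: (z.1 - z.2)).
Proof.
apply: measurable_fun_rVP => i; under eq_fun do rewrite !mxE.
apply: measurable_funM => //; apply: measurable_funB.
  exact: (measurableT_comp (@measurable_coord R d i) measurable_fst).
exact: (measurableT_comp (@measurable_coord R d i) measurable_snd).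
Qed.

Lemma enorm_diff_cube x y : unit_cube R d x -> unit_cube R d y ->
  enorm (x - y) <= Num.sqrt d%:R.
Proof.
move=> xC yC; rewrite -[leRHS]mulr1; apply: enorm_le_box => i.
have := xC i; have := yC i; rewrite /= !in_itv/= !mxE => /andP[y0 y1] /andP[x0 x1].
by rewrite ler_norml; apply/andP; split; lra.
Qed.

Definition riesz_energy (p : R) : \bar R :=
  (\int[mu \x mu]_z riesz p (enorm (z.1 - z.2)%R))%E.

Lemma measurable_riesz_diff (p : R) : measurable_fun setT
  (fun z : 'rV[R]_d * 'rV[R]_d => riesz p (enorm (z.1 - z.2))).
Proof.
apply: (measurableT_comp (measurable_riesz p)).
apply: (measurableT_comp measurable_enorm).
under eq_fun do rewrite -[_ - _]scale1r.
exact: measurable_diff_pair.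
Qed.

(** For fixed [x] the inner integral is bounded independently of [x], and the
    outer measure has mass [1]. *)
Lemma riesz_energy_fin_num (p : R) : 0 < p < d%:R ->
  riesz_energy p \is a fin_num.
Proof.
move=> pd; have [C C0 HC] := @integral_riesz_pow_le R d p pd.
rewrite ge0_fin_numE; last by apply: integral_ge0 => z _; exact: riesz_ge0.
rewrite /riesz_energy fubini_tonelli1//=; last 2 first.
- exact: measurable_riesz_diff.
- by move=> z; exact: riesz_ge0.
apply: (@le_lt_trans _ _ (\int[mu]_x (\prod_(i < d) (1 + C%:E)))%E).
  apply: ge0_le_integral => //.
  - by move=> x _; apply: integral_ge0 => y _; exact: riesz_ge0.
  - apply: measurable_fun_fubini_tonelli_F.
      exact: measurable_riesz_diff.
    by move=> z; exact: riesz_ge0.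
  move=> x _; rewrite /fubini_F/= ge0_integral_mrestr//; last 2 first.
  - exact: (measurableT_comp (measurable_riesz_diff p) (pair1_measurable x)).
  - by move=> y; exact: riesz_ge0.
  apply: le_trans (HC _ _ _) _; first exact: measurable_itv.
  by rewrite lebesgue_measure_itv/= lte_fin ltr01 oppr0 adde0.
by rewrite integral_cst// [X in (_ * X)%E](cube_probT R d) mule1 -EFinD prodEFin ltry.
Qed.

End cube_pairs.

(** * Differences of power terms *)

Section power_term.
Context {R : realType}.
Implicit Types p q a b r s : R.

Lemma is_derive_power_term p r : 0 < r ->
  is_derive r 1 (power_term p) (r `^ (p - 1)).
Proof.
move=> r0; rewrite /power_term; have [->|p0] := eqVneq p 0.
  rewrite sub0r powR_inv1 ?ltW//; exact: is_derive1_ln.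
have H := @is_derive1_powR R p r r0.
have E : (fun t => t `^ p / p) = p^-1 \*: (fun t : R => t `^ p : R).
  by apply/funext => t /=; rewrite mulrC.
have /= := is_deriveZ p^-1 H; rewrite -E /GRing.scale/= mulKf//.
Qed.

Lemma power_term0 r : power_term 0 r = ln r.
Proof. by rewrite /power_term eqxx. Qed.

Lemma power_termV p r : 0 < r -> power_term p r^-1 = - power_term (- p) r.
Proof.
move=> r0; rewrite /power_term oppr_eq0; case: ifPn => p0; first by rewrite lnV.
by rewrite invrN mulrN opprK powRN -powR_inv1 ?ltW// powRAC powR_inv1 ?powR_ge0.
Qed.

Definition power_diff a b r := power_term a r - power_term b r.

Lemma is_derive_power_diff a b r : 0 < r ->
  is_derive r 1 (power_diff a b) (r `^ (a - 1) - r `^ (b - 1)).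
Proof. by move=> r0; apply: is_deriveB; exact: is_derive_power_term. Qed.

Lemma continuous_power_diff a b r : 0 < r ->
  {for r, continuous (power_diff a b)}.
Proof.
move=> r0; apply: differentiable_continuous; apply/derivable1_diffP.
by have [] := is_derive_power_diff a b r r0.
Qed.

Lemma MVT_pos (f df : R -> R) r s :
  (forall t : R, 0 < t -> is_derive t (1 : R) f (df t)) -> 0 < r -> r < s ->
  exists2 t, r < t < s & f s - f r = df t * (s - r).
Proof.
move=> fdf r0 rs; have [t|t|t] := @MVT R f df r s rs.
- rewrite in_itv/= => /andP[rt _]; apply: fdf; exact: lt_trans rt.
- apply: derivable_within_continuous => u; rewrite in_itv/= => /andP[ru _].
  by have [] := fdf u (lt_le_trans r0 ru).
by rewrite in_itv => ? ?; exists t.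
Qed.

Lemma power_diff_incr a b r s : b < a -> 1 <= r -> r < s ->
  power_diff a b r < power_diff a b s.
Proof.
move=> ba r1 rs; have r0 : 0 < r by apply: lt_le_trans r1.
have [t /andP[rt ts] E] := MVT_pos _ _ _ _ (is_derive_power_diff a b) r0 rs.
rewrite -subr_gt0 E mulr_gt0 ?subr_gt0//.
by apply: gt1_ltr_powR; [exact: le_lt_trans rt|rewrite ltrD2r].
Qed.

Lemma power_diffV a b r : 0 < r -> power_diff a b r^-1 = power_diff (- b) (- a) r.
Proof. by move=> r0; rewrite /power_diff !power_termV// opprK addrC. Qed.

(** [power_diff a b] increases on [r >= 1], and on [r <= 1] it decreases because
    [power_diffV] maps that case to the previous one. *)
Lemma power_diff_ge1 a b r : b <= a -> 0 < r ->
  power_diff a b 1 <= power_diff a b r.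
Proof.
rewrite le_eqVlt => /predU1P[->|ba r0]; first by rewrite /power_diff !subrr.
have [r1|r1|->//] := ltgtP r 1; last exact/ltW/power_diff_incr.
rewrite -[r]invrK -[X in power_diff _ _ X <= _]invr1.
rewrite power_diffV// [leRHS]power_diffV ?invr_gt0//.
by rewrite ltW// power_diff_incr ?ltrN2// invf_gt1.
Qed.

(** [power_diff a b - power_diff 0 (b - a)] has the derivative
    [(t ^ a - 1) * (t ^ (- 1) - t ^ (b - a - 1))], which is nonnegative for
    [t >= 1], and [power_diff 0 (b - a) r >= ln r]. *)
Lemma power_diff_ge_ln a b r : 0 <= a -> b < a -> 1 <= r ->
  ln r + (power_diff a b 1 - power_diff 0 (b - a) 1) <= power_diff a b r.
Proof.
move=> a0 ba r1.
have T0 u : power_term (b - a) u <= 0.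
  rewrite /power_term subr_eq0 lt_eqF//.
  by rewrite mulr_ge0_le0 ?powR_ge0// invr_le0 subr_le0 ltW.
have P0 u : power_diff 0 (b - a) u = ln u - power_term (b - a) u.
  by rewrite /power_diff power_term0.
move: r1; rewrite le_eqVlt => /predU1P[<-|r1].
  by have := T0 1; rewrite P0 ln1; lra.
pose f := power_diff a b - power_diff 0 (b - a).
have df (t : R) : 0 < t -> is_derive t (1 : R) f
    (t `^ (a - 1) - t `^ (b - 1) - (t `^ (0 - 1) - t `^ (b - a - 1))).
  by move=> t0; apply: is_deriveB; exact: is_derive_power_diff.
have [t /andP[t1 _] E] := MVT_pos _ _ _ _ df ltr01 r1.
have t0 : 0 < t by apply: lt_trans t1.
have : 0 <= f r - f 1.
  rewrite E mulr_ge0//; last by rewrite subr_ge0 ltW.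
  rewrite (_ : _ - _ = (t `^ a - 1) * (t `^ (0 - 1) - t `^ (b - a - 1))).
    rewrite mulr_ge0// subr_ge0.
      by rewrite -[leLHS](powRr0 t) ler_powR// ltW.
    by rewrite ler_powR ?ltW// ltrD2r subr_lt0.
  have tn0 : t != 0 by rewrite gt_eqF.
  rewrite mulrBl mulrBr -!powRD ?tn0 ?implybT// mul1r.
  by congr (t `^ _ - t `^ _ - _); ring.
have -> : f r = power_diff a b r - power_diff 0 (b - a) r by [].
have -> : f 1 = power_diff a b 1 - power_diff 0 (b - a) 1 by [].
by have := T0 r; rewrite !P0; lra.
Qed.

Lemma power_diff_cvgy a b A : 0 <= a -> b < a ->
  exists2 M, 1 <= M & forall r, M < r -> A < power_diff a b r.
Proof.
move=> a0 ba; set K := power_diff a b 1 - power_diff 0 (b - a) 1.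
exists (Num.max 1 (expR (A - K))); first by rewrite le_max lexx.
move=> r; rewrite gt_max => /andP[r1 rA].
have r0 : 0 < r by apply: lt_trans r1.
apply: lt_le_trans (power_diff_ge_ln a b r a0 ba (ltW r1)).
by rewrite -ltrBlDr -ltr_expR lnK.
Qed.

Lemma power_term_cvg0 p e : p < 0 -> 0 < e ->
  exists2 M, 1 <= M & forall r, M < r -> `|power_term p r| < e.
Proof.
move=> p0 e0; have ep : 0 < e * `|p| by rewrite mulr_gt0// normr_gt0 lt_eqF.
exists (Num.max 1 ((e * `|p|)^-1 `^ (- p)^-1)); first by rewrite le_max lexx.
move=> r; rewrite gt_max => /andP[r1 rM].
have r0 : 0 < r by apply: lt_trans r1.
rewrite /power_term lt_eqF// normrM normfV ltr_pdivrMr ?normr_gt0 ?lt_eqF//.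
rewrite ger0_norm ?powR_ge0// -[p in r `^ p]opprK powRN.
rewrite invf_plt ?posrE ?powR_gt0//.
have := @gt0_ltr_powR R (- p) _ _ _ _ _ rM.
rewrite -powRrM mulVf ?oppr_eq0 ?lt_eqF// powRr1 ?invr_ge0 ?ltW//.
by apply; rewrite ?oppr_gt0// nnegrE ?powR_ge0// ltW.
Qed.

(** Near the origin [power_diff a b] is at most of the order of the kernel
    [r ^ (- p)], because [power_term] increases with its exponent up to an
    additive constant. *)
Lemma power_diff_le_powR a b p M : b < a -> 0 < p -> - p <= b -> 0 < M ->
  exists2 A, 0 < A & forall r, 0 < r -> r <= M ->
    `|power_diff a b r| <= A * r `^ (- p).
Proof.
move=> ba p0 pb M0; set a' := Num.max a 1.
have a'0 : 0 < a' by rewrite lt_max ltr01 orbT.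
set c1 := `|power_diff a b 1|.
set c2 := `|power_diff a' a 1|.
set c3 := `|power_diff b (- p) 1|.
(* [power_diff a b] lies between [- c1] and
   [power_term a' - power_term (- p) + c2 + c3] *)
set K := c1 + c2 + c3 + M `^ a' / a'.
have c10 : 0 <= c1 := normr_ge0 _.
have c20 : 0 <= c2 := normr_ge0 _.
have c30 : 0 <= c3 := normr_ge0 _.
have Ma0 : 0 <= M `^ a' / a' by rewrite divr_ge0 ?powR_ge0 ?(ltW a'0).
have K0 : 0 <= K by rewrite /K; lra.
exists (p^-1 + K * M `^ p).
  by rewrite ltr_wpDr ?invr_gt0// mulr_ge0 ?powR_ge0.
move=> r r0 rM.
have le1 : 1 <= M `^ p * r `^ (- p).
  rewrite powRN ler_pdivlMr ?powR_gt0// mul1r.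
  by rewrite ge0_ler_powR ?nnegrE// ltW.
have l1 : power_diff a b 1 <= power_diff a b r by rewrite power_diff_ge1// ltW.
have l2 : power_diff a' a 1 <= power_diff a' a r.
  by rewrite power_diff_ge1// le_max lexx.
have l3 : power_diff b (- p) 1 <= power_diff b (- p) r by rewrite power_diff_ge1.
have n1 : - c1 <= power_diff a b 1 by rewrite -lerNl ler_normr lexx orbT.
have n2 : - c2 <= power_diff a' a 1 by rewrite -lerNl ler_normr lexx orbT.
have n3 : - c3 <= power_diff b (- p) 1 by rewrite -lerNl ler_normr lexx orbT.
have ta : power_term a' r <= M `^ a' / a'.
  rewrite /power_term gt_eqF// ler_pM2r ?invr_gt0//.
  by rewrite ge0_ler_powR ?nnegrE// ltW.
have tp : power_term (- p) r = - (p^-1 * r `^ (- p)).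
  by rewrite /power_term oppr_eq0 gt_eqF// invrN mulrN mulrC.
have KM : K <= K * M `^ p * r `^ (- p).
  by rewrite -mulrA ler_peMr.
have pr : 0 <= p^-1 * r `^ (- p) by rewrite mulr_ge0 ?powR_ge0// invr_ge0 ltW.
move: l1 l2 l3 n1 n2 n3; rewrite /power_diff tp => l1 l2 l3 n1 n2 n3.
by rewrite mulrDl ler_norml; apply/andP; rewrite /K in KM *; split; lra.
Qed.

End power_term.

(** * Radial potentials *)

Lemma prod_probability_integrable_cst d1 d2 (T1 : measurableType d1)
    (T2 : measurableType d2) (R : realType) (P1 : probability T1 R)
    (P2 : probability T2 R) (k : R) :
  (P1 \x P2)%E.-integrable setT (fun=> k%:E).
Proof.
exact: (finite_measure_integrable_cst
  [the probability _ _ of (P1 \x P2)%E] k measurableT).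
Qed.

Section radial.
Context {R : realType} {d : nat}.
Implicit Types (w : R -> \bar R) (W : 'rV[R]_d -> \bar R).

(** The sets where [W] exceeds a constant are open, and they generate. *)
Lemma lower_semicontinuous_measurable_rV W :
  lower_semicontinuous W -> measurable_fun setT W.
Proof.
move=> lscW; apply: (measurability _ (ErealGenOInfty.measurableE R)).
move=> /= _ [_ [a ->]] <-; rewrite setTI; apply: open_measurable_rV.
by rewrite preimage_itvoy; move/lower_semicontinuousP : lscW; exact.
Qed.

Lemma lower_semicontinuous_radial w :
  (forall r (a : R), 0 <= r -> (a%:E < w r)%E ->
    \forall s \near r, 0 <= s -> (a%:E < w s)%E) ->
  lower_semicontinuous (fun x : 'rV[R]_d => w (enorm x)).
Proof.
move=> lscw x a /(lscw _ _ (enorm_ge0 x)) near_w.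
exists [set y | (a%:E < w (enorm y))%E]; last by [].
have near_W : \forall y \near x, 0 <= enorm y -> (a%:E < w (enorm y))%E.
  exact: (@continuous_enorm R d x _ near_w).
apply: filterS near_W => y yP.
exact/yP/enorm_ge0.
Qed.

Lemma coordinatewise_increasing_radial w (R6 : R) : 0 < R6 ->
  (forall r s, R6 <= r -> r < s -> (w r < w s)%E) ->
  coordinatewise_increasing (fun x : 'rV[R]_d => w (enorm x)).
Proof.
move=> R60 incw; exists R6 => // k x y xy xk xyk; apply: incw.
  apply: le_trans (le_coord_enorm x k); apply: le_trans xk _; exact: ler_norm.
have xk0 : 0 < x ord0 k by apply: lt_le_trans xk.
rewrite /enorm ltr_sqrt.
  rewrite (bigD1 k)//= [ltRHS](bigD1 k)//= ltr_leD//.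
    by rewrite ltrXn2r// ltW.
  by rewrite ler_sum// => i ik; rewrite xy.
rewrite (bigD1 k)//= ltr_pwDl ?exprn_gt0 ?(lt_trans xk0)//.
by rewrite sumr_ge0// => i _; exact: sqr_ge0.
Qed.

Lemma cvg_radial w (l : \bar R) : w r @[r --> +oo] --> l ->
  w (enorm x) @[x --> @enorm_infty R d] --> l.
Proof.
move=> wl; apply: cvg_comp wl => A [M [_ MA]].
by exists M => // x /= /MA.
Qed.

(** On a bounded set a constant is also at most a multiple of [|x| ^ (- p)], so a
    single domination covers both the origin and the rest of the ball. *)
Lemma locally_integrable_riesz W (p : R) : measurable_fun setT W ->
  0 < p < d%:R ->
  (forall M, 0 < M -> exists2 A : R, 0 <= A & forall x, enorm x <= M ->
     (`|W x| <= A%:E * riesz p (enorm x))%E) ->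
  locally_integrable_rV W.
Proof.
move=> mW pd Wle x r r0.
have [C C0 HC] := @integral_riesz_pow_le R d p pd.
pose N := enorm x + r.
have ballN y : eball x r y -> forall i, `|y ord0 i| <= N.
  move=> yr i; rewrite -[y](subrK x) mxE.
  rewrite (le_trans (ler_normD _ _))// addrC lerD ?le_coord_enorm//.
  exact: le_trans (le_coord_enorm _ _) (ltW yr).
have N0 : 0 < N by rewrite /N ltr_wpDl ?enorm_ge0.
have [A A0 HA] := Wle (Num.sqrt d%:R * N + 1) (ltr_wpDl (mulr_ge0 (sqrtr_ge0 _) (ltW N0)) ltr01).
pose D : set R := [set` `[- N, N]].
have mD : measurable D by exact: measurable_itv.
have mB : measurable (eball x r).
  have msub : measurable_fun setT (fun y : 'rV[R]_d => y - x).
    apply: measurable_fun_rVP => i; under eq_fun do rewrite !mxE.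
    by apply: measurable_funB => //; exact: measurable_coord.
  have := measurableT_comp measurable_enorm msub.
  move=> /(_ measurableT _ (measurable_itv `]-oo, r[)); rewrite setTI.
  by congr (measurable _); apply/seteqP; split=> y; rewrite /= in_itv.
have mR : measurable_fun setT (fun y : 'rV[R]_d => riesz p (enorm y)).
  exact: (measurableT_comp (measurable_riesz p) measurable_enorm).
have ARoo : (\int[lebesgue_rV R d]_(y in rV_pow D) (A%:E * riesz p (enorm y)) < +oo)%E.
  rewrite ge0_integralZl//; last 3 first.
  - exact: measurable_rV_pow.
  - exact: measurable_funTS.
  - by move=> y _; exact: riesz_ge0.
  rewrite lte_mul_pinfty//.
  under eq_integral do rewrite -enormN -sub0r.
  apply: le_lt_trans (HC D 0 mD) _.
  rewrite /D lebesgue_measure_itv/= lte_fin gtrN// -EFinB -EFinD.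
  by rewrite prodEFin ltry.
apply/integrableP; split; first exact: measurable_funTS.
apply: le_lt_trans ARoo.
apply: (@le_trans _ _ (\int[lebesgue_rV R d]_(y in eball x r) (A%:E * riesz p (enorm y)))%E).
  apply: ge0_le_integral => //.
  - by apply: measurableT_comp => //; exact: measurable_funTS.
  - by apply: measurable_funeM; exact: measurable_funTS.
  - move=> y yr; apply: HA; rewrite ler_wpDr// enorm_le_box//.
    exact: ballN.
apply: ge0_subset_integral => //.
- exact: measurable_rV_pow.
- by apply: measurable_funeM; exact: measurable_funTS.
- by move=> y _; rewrite mule_ge0 ?riesz_ge0.
- move=> y /ballN yN i; rewrite /D/= in_itv/= -ler_norml; exact: yN.
Qed.

Lemma interaction_energy_dilate W (L : R) : measurable_fun setT W ->
  interaction_energy W (cube_probL R d L) =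
  ((2^-1)%:E * \int[cube_prob R d \x cube_prob R d]_z W (L *: (z.1 - z.2))%R)%E.
Proof.
move=> mW; rewrite /interaction_energy integral_dilate.
  by congr (_ * _)%E; apply: eq_integral => z _ /=; rewrite scalerBr.
apply: (measurableT_comp mW).
under eq_fun do rewrite -[_ - _]scale1r.
exact: measurable_diff_pair.
Qed.

(** Differences of points of the unit cube have norm at most [sqrt d]; this is
    where the bound on the rescaled potential is needed. *)
Lemma interaction_energy_le W (L A B p : R) : measurable_fun setT W ->
  0 < p < d%:R -> 0 <= A ->
  (forall x, enorm x <= Num.sqrt d%:R ->
    (W (L *: x) <= A%:E * riesz p (enorm x) + B%:E)%E) ->
  (interaction_energy W (cube_probL R d L) <=
   (2^-1 * (A * fine (@riesz_energy R d p) + B))%:E)%E.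
Proof.
move=> mW pd A0 WAB; rewrite interaction_energy_dilate// EFinM.
apply: lee_wpmul2l; first by rewrite lee_fin.
have mR := @measurable_riesz_diff R d p.
have R0 (z : 'rV[R]_d * 'rV[R]_d) : (0 <= riesz p (enorm (z.1 - z.2)%R))%E.
  exact: riesz_ge0.
have foo := @riesz_energy_fin_num R d p pd.
have int1 : (cube_prob R d \x cube_prob R d)%E.-integrable setT
   (fun z => A%:E * riesz p (enorm (z.1 - z.2)%R))%E.
  apply: integrableZl => //; apply/integrableP; split => //.
  under eq_integral do rewrite gee0_abs//.
  by rewrite -ge0_fin_numE//; apply: integral_ge0.
apply: (@le_trans _ _ (\int[cube_prob R d \x cube_prob R d]_z
    (A%:E * riesz p (enorm (z.1 - z.2)%R) + B%:E))%E).
  apply: le_integral_cube2.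
  - exact: (measurableT_comp mW (measurable_diff_pair L)).
  - by apply: emeasurable_funD => //; exact: measurable_funeM.
  - by move=> x y xC yC; apply: WAB; exact: enorm_diff_cube.
rewrite integralD//; last first.
  exact: (prod_probability_integrable_cst _ _ _ _ _ (cube_prob R d) (cube_prob R d)).
rewrite ge0_integralZl// integral_cst// -/(@riesz_energy R d p).
by rewrite [X in (_ + _ * X)%E](probability_setT _) mule1 EFinD EFinM fineK.
Qed.

End radial.

(** * The power-law potential *)

Section power_law.
Context {R : realType}.
Implicit Types a b r s : R.

Definition power_profile a b r : \bar R :=
  if r == 0 then if 0 < b then 0%E else +oo%E else (power_diff a b r)%:E.

Lemma power_lawE (d : nat) a b :
  @power_law R d a b = fun x => power_profile a b (enorm x).
Proof.
by apply/funext => x; rewrite /power_law /power_profile enorm_eq0.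
Qed.

Lemma power_profile_pos a b r : 0 < r ->
  power_profile a b r = (power_diff a b r)%:E.
Proof. by move=> r0; rewrite /power_profile gt_eqF. Qed.

(** By [power_termV] and [power_diffV], small [s] corresponds to large [s^-1]:
    for [b > 0] the term of exponent [- b] tends to [0] at infinity, and for
    [b <= 0] the difference of exponents [- b] and [- a] tends to [+oo]. *)
Lemma power_profile_near0 a b (c : R) : b < a ->
  (c%:E < power_profile a b 0)%E ->
  exists2 e, 0 < e & forall s, 0 < s -> s < e -> c < power_diff a b s.
Proof.
move=> ba; rewrite /power_profile eqxx; have [b0 c0|b0 _] := ltP 0 b.
  have bn : - b < 0 by rewrite oppr_lt0.
  have cn : 0 < - c by rewrite oppr_gt0 -lte_fin.
  have [M M1 HM] := power_term_cvg0 _ _ bn cn.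
  have M0 : 0 < M by apply: lt_le_trans M1.
  exists M^-1 => [|s s0 sM]; first by rewrite invr_gt0.
  have /HM : M < s^-1 by rewrite -[M]invrK ltf_pV2 ?posrE// invr_gt0.
  rewrite power_termV// opprK normrN => sc.
  have Ta : 0 <= power_term a s.
    have a0 : 0 < a by apply: lt_trans ba.
    by rewrite /power_term gt_eqF// divr_ge0 ?powR_ge0 ?ltW.
  have := ler_norm (power_term b s); rewrite /power_diff; lra.
have nb0 : 0 <= - b by rewrite oppr_ge0.
have nba : - a < - b by rewrite ltrN2.
have [M M1 HM] := power_diff_cvgy _ _ c nb0 nba.
have M0 : 0 < M by apply: lt_le_trans M1.
exists M^-1 => [|s s0 sM]; first by rewrite invr_gt0.
have /HM : M < s^-1 by rewrite -[M]invrK ltf_pV2 ?posrE// invr_gt0.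
by rewrite power_diffV// !opprK.
Qed.

Lemma power_profile_lsc a b r (c : R) : b < a -> 0 <= r ->
  (c%:E < power_profile a b r)%E ->
  \forall s \near r, 0 <= s -> (c%:E < power_profile a b s)%E.
Proof.
move=> ba; rewrite le_eqVlt => /predU1P[<-|r0] cr.
  have [e e0 He] := power_profile_near0 a b c ba cr.
  near=> s => s0; have [->//|sn0] := eqVneq s 0.
  have {}s0 : 0 < s by rewrite lt_neqAle eq_sym sn0.
  rewrite power_profile_pos// lte_fin He//.
  by near: s; exact: lt_nbhsl.
rewrite power_profile_pos// lte_fin in cr.
near=> s => _; rewrite power_profile_pos//; last by near: s; exact: lt_nbhsr.
rewrite lte_fin; near: s.
by apply: (@cvgr_gt _ _ _ _ _ _ (continuous_power_diff a b r r0)).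
Unshelve. all: by end_near. Qed.

Lemma power_profile_cvg a b : b < a -> power_profile a b r @[r --> +oo] -->
  (if 0 <= a then +oo%E else 0%E : \bar R).
Proof.
move=> ba; have [a0|a0] := leP 0 a.
  apply/cvgeyPgt => A; have [M M1 HM] := power_diff_cvgy a b A a0 ba.
  near=> r; rewrite power_profile_pos; last first.
    by near: r; exact: (nbhs_pinfty_gt (num_real _)).
  by rewrite lte_fin; apply: HM; near: r; exact: (nbhs_pinfty_gt (num_real _)).
apply: cvg_EFin.
  near=> r; rewrite power_profile_pos//; near: r; exact: (nbhs_pinfty_gt (num_real _)).
apply/cvgrPdist_lt => e e0.
have b0 : b < 0 by apply: lt_trans a0.
have e20 : 0 < e / 2 by rewrite divr_gt0.
have [M M1 HM] := power_term_cvg0 _ _ a0 e20.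
have [N N1 HN] := power_term_cvg0 _ _ b0 e20.
near=> r; rewrite /= power_profile_pos/=; last by near: r; exact: (nbhs_pinfty_gt (num_real _)).
rewrite sub0r normrN (le_lt_trans (ler_normB _ _))//.
rewrite [e]splitr ltrD ?HM ?HN//; near: r; exact: (nbhs_pinfty_gt (num_real _)).
Unshelve. all: by end_near. Qed.

Lemma power_profile_bounded_below a b r : b < a -> 0 <= r ->
  ((- (`|power_diff a b 1| + 1))%:E <= power_profile a b r)%E.
Proof.
move=> ba; rewrite le_eqVlt => /predU1P[<-|r0].
  rewrite /power_profile eqxx; case: ifP => _; last exact: leey.
  by rewrite lee_fin oppr_le0 addr_ge0.
rewrite power_profile_pos// lee_fin.
apply: le_trans (power_diff_ge1 _ _ _ (ltW ba) r0).
have := ler_norm (- power_diff a b 1); rewrite normrN; lra.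
Qed.

Lemma power_profile_le_riesz a b p M : b < a -> 0 < p -> - p <= b -> 0 < M ->
  exists2 A : R, 0 <= A & forall r, 0 <= r -> r <= M ->
    (`|power_profile a b r| <= A%:E * riesz p r)%E.
Proof.
move=> ba p0 pb M0; have [A A0 HA] := power_diff_le_powR a b p M ba p0 pb M0.
exists A; first exact: ltW.
move=> r; rewrite le_eqVlt => /predU1P[<-|r0] rM.
  by rewrite /riesz eqxx gt0_muley ?lte_fin// leey.
by rewrite power_profile_pos// /riesz gt_eqF// -EFinM/= lee_fin HA.
Qed.

(** The repulsive part contributes a multiple of [L ^ b]; the attractive part is
    at most [- c L ^ a] because [|x| <= sqrt d] and [a < 0].  As [b < a], the
    latter wins for large [L]. *)
Lemma power_law_energy_lt0 (d : nat) a b : (0 < d)%N -> - d%:R < b -> b < a ->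
  a < 0 -> exists L : R,
    (interaction_energy (@power_law R d a b) (cube_probL R d L) < 0)%E.
Proof.
move=> d0 db ba a0; have b0 : b < 0 by apply: lt_trans a0.
have pd : 0 < - b < d%:R by rewrite oppr_gt0 b0 ltrNl.
set M := Num.sqrt d%:R : R.
have M0 : 0 < M by rewrite sqrtr_gt0 ltr0n.
set I := fine (@riesz_energy R d (- b)).
have I0 : 0 <= I.
  by rewrite fine_ge0//; apply: integral_ge0 => z _; exact: riesz_ge0.
set c := M `^ a / - a.
have c0 : 0 < c by rewrite divr_gt0 ?powR_gt0// oppr_gt0.
have nb0 : 0 < - b by rewrite oppr_gt0.
have ab0 : 0 < a - b by rewrite subr_gt0.
(* chosen so that [L ^ (a - b) * c > I / - b] *)
set Q := I / - b / c + 1.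
have Q0 : 0 < Q.
  by apply: ltr_wpDl => //; apply: (divr_ge0 _ (ltW c0)); apply: divr_ge0 (ltW nb0).
set L := Q `^ (a - b)^-1.
have L0 : 0 < L by rewrite powR_gt0.
exists L.
have A0 : 0 < L `^ b / - b by rewrite divr_gt0 ?powR_gt0.
have mW : measurable_fun setT (@power_law R d a b).
  rewrite power_lawE; apply: lower_semicontinuous_measurable_rV.
  by apply: lower_semicontinuous_radial => r ? ? ?; exact: power_profile_lsc.
apply: (@le_lt_trans _ _ (2^-1 * (L `^ b / - b * I + - (L `^ a * c)))%:E).
  apply: interaction_energy_le => //; first exact: ltW.
  move=> x xM; rewrite power_lawE enormZ ?(ltW L0)//.
  have := enorm_ge0 x; rewrite le_eqVlt => /predU1P[<-|x0].
    by rewrite /riesz eqxx gt0_muley ?lte_fin// addye// leey.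
  rewrite power_profile_pos ?mulr_gt0// /riesz gt_eqF// -EFinM -EFinD lee_fin.
  rewrite /power_diff /power_term !lt_eqF// opprK !powRM ?(ltW L0) ?enorm_ge0//.
  have xa : M `^ a <= enorm x `^ a.
    rewrite -[a]opprK !(powRN _ (- a)) lef_pV2 ?posrE ?powR_gt0//.
    by rewrite ge0_ler_powR ?nnegrE ?oppr_ge0 ?(ltW a0) ?(ltW x0) ?(ltW M0).
  have : L `^ a * enorm x `^ a / a <= L `^ a * M `^ a / a.
    by rewrite ler_nM2r ?invr_lt0// ler_pM2l ?powR_gt0.
  by rewrite /c !invrN; lra.
rewrite lte_fin pmulr_rlt0// subr_lt0.
have -> : L `^ a = Q * L `^ b.
  rewrite -[X in L `^ X](subrK b) powRD; last by rewrite [L == 0]gt_eqF// implybT.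
  by rewrite -powRrM mulVf ?gt_eqF// powRr1 ?(ltW Q0).
rewrite [_ * L `^ b]mulrC -!mulrA ltr_pM2l ?powR_gt0//.
by rewrite mulrC -ltr_pdivrMr// ltrDl.
Qed.

Lemma power_law_hypotheses (d : nat) a b : (0 < d)%N -> - d%:R < b -> b < a ->
  potential_hypotheses (@power_law R d a b).
Proof.
move=> d0 db ba.
have lscW : lower_semicontinuous (@power_law R d a b).
  rewrite power_lawE.
  by apply: lower_semicontinuous_radial => r ? ? ?; exact: power_profile_lsc.
have mW := lower_semicontinuous_measurable_rV _ lscW.
have dR0 : 0 < d%:R :> R by rewrite ltr0n.
(* an exponent [p] of the open interval from [0] to [d] with [- p <= b] *)
pose p := Num.max (- b) (d%:R / 2).
have pd : 0 < p < d%:R.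
  rewrite lt_max gt_max divr_gt0//= orbT ltrNl db ltr_pdivrMr//.
  by rewrite ltr_pMr// ltr1n.
have [p0 _] := andP pd.
have pb : - p <= b by rewrite lerNl le_max lexx.
have Wle M : 0 < M -> exists2 A : R, 0 <= A & forall x : 'rV[R]_d, enorm x <= M ->
    (`|power_law a b x| <= A%:E * riesz p (enorm x))%E.
  move=> M0; have [A A0 HA] := power_profile_le_riesz a b p M ba p0 pb M0.
  by exists A => // x xM; rewrite power_lawE; exact: HA (enorm_ge0 x) xM.
split => //.
- exists (- (`|power_diff a b 1| + 1)); first by rewrite oppr_lt0 ltr_wpDl.
  by move=> x; rewrite power_lawE; exact: power_profile_bounded_below (enorm_ge0 x).
- exact: locally_integrable_riesz mW pd Wle.
- by move=> x; rewrite power_lawE enormN.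
- exists (if 0 <= a then +oo%E else 0%E); split.
    rewrite power_lawE; exact: cvg_radial (power_profile_cvg a b ba).
  have [a0|a0] := leP 0 a.
    exists (cube_probL R d 1).
    have M0 : 0 < Num.sqrt d%:R :> R by rewrite sqrtr_gt0.
    have [A A0 HA] := Wle _ M0.
    rewrite gt0_muley ?lte_fin ?invr_gt0//.
    apply: le_lt_trans (ltry _).
    apply: (interaction_energy_le _ 1 A 0 p) => // x xM.
    by rewrite scale1r adde0 (le_trans (lee_abs _))// HA.
  have [L HL] := power_law_energy_lt0 d a b d0 db ba a0.
  by exists (cube_probL R d L); rewrite mule0.
rewrite power_lawE; apply: (coordinatewise_increasing_radial _ 1) => // r s r1 rs.
have r0 : 0 < r by apply: lt_le_trans r1.
rewrite (power_profile_pos _ _ _ r0) (power_profile_pos _ _ _ (lt_trans r0 rs)).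
by rewrite lte_fin power_diff_incr.
Qed.

End power_law.

(** * The Morse potential *)

Section morse_profile.
Context {R : realType} (CA CR lA lR : R).
Hypotheses (CA0 : 0 < CA) (CR0 : 0 < CR) (lA0 : 0 < lA) (lR0 : 0 < lR).

Definition morse_profile (r : R) : R :=
  CR * expR (- (r / lR)) - CA * expR (- (r / lA)).

Lemma is_derive_expRN (l r : R) :
  is_derive r (1 : R) (fun t => expR (- (t / l))) (- l^-1 * expR (- (r / l))).
Proof.
have H : is_derive r (1 : R) (fun t : R => - (t / l)) (- l^-1).
  have E : (fun t : R => - (t / l)) = (- l^-1) \*: (@idfun R).
    by apply/funext => t /=; rewrite /GRing.scale/= mulNr mulrC.
  have := is_deriveZ (- l^-1) (is_derive_id r (1 : R)).
  by rewrite -E /GRing.scale/= mulr1.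
have := @is_derive1_comp _ _ _ _ _ _ (is_derive_expR _) H.
by rewrite mulrC.
Qed.

Lemma is_derive_morse (r : R) : is_derive r (1 : R) morse_profile
  (CR * (- lR^-1 * expR (- (r / lR))) - CA * (- lA^-1 * expR (- (r / lA)))).
Proof.
apply: is_deriveB; apply: is_deriveZ; exact: is_derive_expRN.
Qed.

Lemma continuous_morse : continuous morse_profile.
Proof.
move=> r; apply: differentiable_continuous; apply/derivable1_diffP.
by have [] := is_derive_morse r.
Qed.

Lemma expRN_le1 (l r : R) : 0 < l -> 0 <= r -> expR (- (r / l)) <= 1.
Proof. by move=> l0 r0; rewrite expR_le1 oppr_le0 divr_ge0 ?(ltW l0). Qed.

Lemma cvg_expRN (l : R) : 0 < l -> expR (- (r / l)) @[r --> +oo] --> 0.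
Proof.
move=> l0; apply: (@cvg_comp _ _ _ (fun r => r / l) (fun r => expR (- r))
  _ _ _ _ (@cvgr_expR R)).
by apply: gt0_cvgMly; [rewrite invr_gt0|exact: cvg_id].
Qed.

Lemma morse_cvg0 : (morse_profile r)%:E @[r --> +oo] --> (0%E : \bar R).
Proof.
apply: cvg_EFin; first exact: nearW.
rewrite [X in _ --> X](_ : 0 = CR * 0 - CA * 0); last by rewrite !mulr0 subr0.
by apply: cvgB; apply: cvgM; [exact: cvg_cst|exact: cvg_expRN|exact: cvg_cst|exact: cvg_expRN].
Qed.

(** The derivative is positive as soon as
    [exp (t (1 / lR - 1 / lA)) > (CR / lR) / (CA / lA)]. *)
Lemma morse_incr : lR < lA -> exists2 R6, 0 < R6 &
  forall r s, R6 <= r -> r < s -> morse_profile r < morse_profile s.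
Proof.
move=> lRA; set D := lR^-1 - lA^-1.
have D0 : 0 < D by rewrite subr_gt0 ltf_pV2.
set K := (CR / lR) / (CA / lA).
have K0 : 0 < K by rewrite !divr_gt0.
exists (Num.max 1 (ln K / D)); first by rewrite lt_max ltr01.
move=> r s; rewrite ge_max => /andP[r1 rK] rs.
have r0 : 0 < r by apply: lt_le_trans r1.
have [t /andP[rt _] E] := MVT_pos _ _ _ _ (fun t _ => is_derive_morse t) r0 rs.
rewrite -subr_gt0 E mulr_gt0 ?subr_gt0//.
have : K < expR (t * D).
  by rewrite -[K]lnK// ltr_expR -ltr_pdivrMr// (le_lt_trans rK).
rewrite /K ltr_pdivrMr ?divr_gt0// [expR _ * _]mulrC => tK.
have -> : - (t / lA) = t * D - t / lR by rewrite /D; ring.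
rewrite expRD.
have e0 := expR_gt0 (- (t / lR)).
have : CR / lR * expR (- (t / lR)) < CA / lA * expR (t * D) * expR (- (t / lR)).
  by rewrite ltr_pM2r.
lra.
Qed.

End morse_profile.

Section exp_energy.
Context {R : realType} {d : nat}.
Local Notation mu := (cube_prob R d).

(** Normalised double integral of [exp (- s |x - y|)] over the unit cube; by
    scaling it is also that of [exp (- |x - y| / l)] over the cube of side
    [s * l]. *)
Definition exp_energy (s : R) : R :=
  fine (\int[mu \x mu]_z (expR (- (s * enorm (z.1 - z.2)%R)))%:E)%E.

Lemma measurable_exp_diff (s : R) : measurable_fun setT
  (fun z : 'rV[R]_d * 'rV[R]_d => (expR (- (s * enorm (z.1 - z.2))))%:E).
Proof.
apply/measurable_EFinP.
have mE : measurable_fun setT (fun r : R => expR (- (s * r))).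
  apply: measurableT_comp => //.
  by apply: measurableT_comp => //; exact: measurable_funM.
apply: (measurableT_comp mE).
apply: (measurableT_comp measurable_enorm).
under eq_fun do rewrite -[_ - _]scale1r.
exact: measurable_diff_pair.
Qed.

Lemma integrable_exp_diff (s : R) : 0 <= s ->
  (mu \x mu)%E.-integrable setT
    (fun z => (expR (- (s * enorm (z.1 - z.2)%R)))%:E).
Proof.
move=> s0.
apply: le_integrable (prod_probability_integrable_cst _ _ _ _ _ mu mu 1) => //.
  exact: measurable_exp_diff.
move=> z _ /=; rewrite lee_fin normr1 ger0_norm ?expR_ge0// expR_le1 oppr_le0.
by rewrite mulr_ge0 ?enorm_ge0.
Qed.

Lemma exp_energyE (s : R) : 0 <= s ->
  (\int[mu \x mu]_z (expR (- (s * enorm (z.1 - z.2)%R)))%:E)%E =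
  (exp_energy s)%:E.
Proof.
move=> s0; rewrite fineK//; exact: integrable_fin_num (integrable_exp_diff s s0).
Qed.

Lemma exp_energy_gt0 (s : R) : 0 <= s -> 0 < exp_energy s.
Proof.
move=> s0; rewrite -lte_fin -exp_energyE//.
apply: (@lt_le_trans _ _ (\int[mu \x mu]_z (expR (- (s * Num.sqrt d%:R)))%:E)%E).
  rewrite integral_cst// [X in (_ * X)%E](probability_setT _) mule1 lte_fin.
  exact: expR_gt0.
apply: le_integral_cube2; [exact: measurable_cst|exact: measurable_exp_diff|].
move=> x y xC yC; rewrite lee_fin ler_expR lerN2 ler_wpM2l//.
exact: enorm_diff_cube.
Qed.

(** Raise [u / p <= exp (u / p)] to the power [p]. *)
Lemma expRN_le_powR (p u : R) : 0 < p -> 0 < u -> expR (- u) <= p `^ p * u `^ (- p).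
Proof.
move=> p0 u0; rewrite expRN powRN ler_pdivlMr ?powR_gt0// mulrC.
rewrite ler_pdivrMr ?expR_gt0//.
have -> : expR u = (expR (u / p)) `^ p by rewrite -expRM divfK ?gt_eqF.
rewrite -powRM ?expR_ge0 ?(ltW p0)// ge0_ler_powR ?nnegrE ?(ltW p0) ?(ltW u0)//.
  by rewrite mulr_ge0 ?expR_ge0 ?(ltW p0).
rewrite -ler_pdivrMl// mulrC (le_trans _ (expR_ge1Dx _))//; lra.
Qed.

Lemma exp_energy_le (p s : R) : 0 < p < d%:R -> 0 < s ->
  exp_energy s <= p `^ p * s `^ (- p) * fine (@riesz_energy R d p).
Proof.
move=> pd s0; have [p0 _] := andP pd.
have A0 : 0 <= p `^ p * s `^ (- p) by rewrite mulr_ge0 ?powR_ge0.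
have mR := @measurable_riesz_diff R d p.
rewrite -lee_fin -exp_energyE ?(ltW s0)// EFinM fineK ?riesz_energy_fin_num//.
rewrite -ge0_integralZl//; last by move=> z _; exact: riesz_ge0.
apply: ge0_le_integral => //.
- exact: measurable_exp_diff.
- exact: measurable_funeM.
move=> z _; have := enorm_ge0 (z.1 - z.2).
rewrite le_eqVlt => /predU1P[<-|z0].
  by rewrite /riesz eqxx gt0_muley ?leey// lte_fin mulr_gt0 ?powR_gt0.
rewrite /riesz gt_eqF// -EFinM lee_fin.
rewrite (le_trans (expRN_le_powR p _ p0 _)) ?mulr_gt0//.
by rewrite powRM ?(ltW s0) ?(ltW z0)// mulrA.
Qed.

(** If [k * exp_energy s <= exp_energy (q * s)] held for all [s], iterating
    would give [k ^ n * exp_energy 1 <= exp_energy (q ^ n) = O (q ^ (- n p))]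
    for each [p < d], which fails as soon as [k * q ^ p > 1]. *)
Lemma exp_energy_scaling (k q : R) : (0 < d)%N -> 0 < k -> 1 < q ->
  k^-1 < q ^+ d -> exists2 s, 0 < s & exp_energy (q * s) < k * exp_energy s.
Proof.
move=> d0 k0 q1 kq; have q0 : 0 < q by apply: lt_trans q1.
have lnq : 0 < ln q by rewrite ln_gt0.
(* [p] is taken between [m] and [d], so that [0 < p < d] and [q ^ p > k^-1] *)
pose m := Num.max 0 (ln k^-1 / ln q).
have md : m < d%:R.
  rewrite gt_max ltr0n d0/= ltr_pdivrMr// mulr_natl -lnXn//.
  by rewrite ltr_ln ?posrE ?invr_gt0 ?exprn_gt0.
pose p := (m + d%:R) / 2.
have [mp pd] := midf_lt md.
have p0 : 0 < p by apply: le_lt_trans mp; rewrite le_max lexx.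
have kqp : k^-1 < q `^ p.
  rewrite /powR gt_eqF// -[ltLHS]lnK ?posrE ?invr_gt0// ltr_expR.
  rewrite -ltr_pdivrMr//; apply: le_lt_trans mp.
  by rewrite le_max lexx orbT.
apply: contrapT => noex.
have step s : 0 < s -> k * exp_energy s <= exp_energy (q * s).
  by move=> s0; rewrite leNgt; apply/negP => sk; apply: noex; exists s.
have iter_step n : k ^+ n * exp_energy 1 <= exp_energy (q ^+ n).
  elim: n => [|n IH]; first by rewrite !expr0 mul1r.
  rewrite !exprS; apply: le_trans (step _ _); last by rewrite exprn_gt0.
  by rewrite -mulrA ler_pM2l.
set C := p `^ p * fine (@riesz_energy R d p).
have bound n : exp_energy 1 <= C * ((k * q `^ p)^-1) ^+ n.
  have qn0 : 0 < q ^+ n by rewrite exprn_gt0.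
  have pd' : 0 < p < d%:R by rewrite p0.
  have := le_trans (iter_step n) (exp_energy_le p _ pd' qn0).
  rewrite -ler_pdivlMl ?exprn_gt0// => /le_trans; apply.
  have qnp : (q ^+ n) `^ p = (q `^ p) ^+ n.
    by rewrite -!powR_mulrn ?powR_ge0 ?(ltW q0)// powRAC.
  rewrite /C powRN qnp.
  by rewrite exprVn exprMn invfM le_eqVlt; apply/orP; left; apply/eqP; ring.
have z1 : `|(k * q `^ p)^-1| < 1.
  have kqp1 : 1 < k * q `^ p by rewrite -ltr_pdivrMl// mulr1.
  by rewrite ger0_norm ?invf_lt1 ?invr_ge0 ?(ltW (lt_trans _ kqp1))// (lt_trans _ kqp1).
have := cvgr_lt _ (cvg_geometric C z1) _ (exp_energy_gt0 1 ler01).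
move=> [N _ /(_ N (leqnn N))] /=.
by rewrite ltNge bound.
Qed.

End exp_energy.

Section morse_hypotheses.
Context {R : realType} (d : nat) (CA CR lA lR : R).
Hypotheses (d0 : (0 < d)%N) (CA0 : 0 < CA) (CR0 : 0 < CR) (lA0 : 0 < lA)
  (lR0 : 0 < lR).
Local Notation mu := (cube_prob R d).
Local Notation W := (@morse R d CA CR lA lR).

Lemma morse_lsc : lower_semicontinuous W.
Proof.
apply: (lower_semicontinuous_radial
  (fun r => (morse_profile CA CR lA lR r)%:E)) => r a r0; rewrite lte_fin => ar.
near=> s => _; rewrite lte_fin; near: s.
exact: (cvgr_gt _ (continuous_morse CA CR lA lR r)).
Unshelve. all: by end_near. Qed.

Lemma morse_energyE (L : R) : 0 <= L ->
  interaction_energy W (cube_probL R d L) =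
  (2^-1 * (CR * @exp_energy R d (L / lR) - CA * @exp_energy R d (L / lA)))%:E.
Proof.
move=> L0; have mW := lower_semicontinuous_measurable_rV _ morse_lsc.
rewrite interaction_energy_dilate// EFinM; congr (_ * _)%E.
have LR : 0 <= L / lR by rewrite divr_ge0 ?(ltW lR0).
have LA : 0 <= L / lA by rewrite divr_ge0 ?(ltW lA0).
have intR := integrable_exp_diff _ LR; have intA := integrable_exp_diff _ LA.
rewrite EFinB !EFinM -!exp_energyE//.
rewrite -!integralZl// -integralB//; last 2 first.
- exact: integrableZl.
- exact: integrableZl.
apply: eq_integral => z _; rewrite /morse enormZ//.
by rewrite -!EFinM -EFinB ![L * _ / _]mulrAC.
Qed.

Lemma morse_hypotheses : lR < lA -> CR / CA < (lA / lR) ^+ d ->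
  potential_hypotheses W.
Proof.
move=> lRA CRA; have mW := lower_semicontinuous_measurable_rV _ morse_lsc.
have dR0 : 0 < d%:R :> R by rewrite ltr0n.
split.
- exists (- CA) => [|x]; first by rewrite oppr_lt0.
  have eA : CA * expR (- (enorm x / lA)) <= CA.
    by rewrite ler_piMr ?(ltW CA0)// expRN_le1// enorm_ge0.
  have : 0 <= CR * expR (- (enorm x / lR)) by rewrite mulr_ge0 ?expR_ge0 ?(ltW CR0).
  rewrite /morse lee_fin; lra.
- apply: (locally_integrable_riesz W (d%:R / 2)) => // [|M M0].
    by rewrite divr_gt0//= ltr_pdivrMr// ltr_pMr// ltr1n.
  (* [|W| <= CR + CA], and [M ^ p * |x| ^ (- p) >= 1] for [|x| <= M] *)
  exists ((CR + CA) * M `^ (d%:R / 2)).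
    by rewrite mulr_ge0 ?powR_ge0 ?addr_ge0 ?(ltW CR0) ?(ltW CA0).
  move=> x xM.
  apply: (@le_trans _ _ (((CR + CA) * M `^ (d%:R / 2))%:E * riesz (d%:R / 2) M)%E); last first.
    apply: lee_wpmul2l.
      by rewrite lee_fin mulr_ge0 ?powR_ge0 ?addr_ge0 ?(ltW CR0) ?(ltW CA0).
    by apply: riesz_antitone => //; exact: enorm_ge0.
  rewrite /riesz gt_eqF// -EFinM powRN mulfK ?gt_eqF ?powR_gt0// lee_fin.
  rewrite (le_trans (ler_normB _ _))// lerD// normrM ger0_norm ?(ltW CR0) ?(ltW CA0)//.
    rewrite ger0_norm ?expR_ge0// ler_piMr ?(ltW CR0)//.
    exact: expRN_le1 lR0 (enorm_ge0 x).
  rewrite ger0_norm ?expR_ge0// ler_piMr ?(ltW CA0)//.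
  exact: expRN_le1 lA0 (enorm_ge0 x).
- by move=> x; rewrite /morse enormN.
- exists 0%E; split.
    exact: (cvg_radial (fun r => (morse_profile CA CR lA lR r)%:E) 0%E
      (morse_cvg0 _ _ _ _ lA0 lR0)).
  have [|||s s0 Hs] := @exp_energy_scaling R d (CA / CR) (lA / lR) d0.
  + by rewrite divr_gt0.
  + by rewrite ltr_pdivlMr// mul1r.
  + by rewrite invf_div.
  exists (cube_probL R d (lA * s)); rewrite mule0 morse_energyE ?mulr_ge0 ?ltW//.
  rewrite lte_fin pmulr_rlt0// subr_lt0.
  rewrite [X in CA * exp_energy X](_ : _ = s); last by rewrite mulrC mulKf ?gt_eqF.
  by rewrite [lA * s / lR]mulrAC -ltr_pdivlMl// mulrA [CR^-1 * CA]mulrC.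
- exact: morse_lsc.
have [R6 R60 incr] := morse_incr CA CR lA lR CA0 CR0 lA0 lR0 lRA.
exact: (coordinatewise_increasing_radial
  (fun r => (morse_profile CA CR lA lR r)%:E) R6 R60 incr).
Qed.

End morse_hypotheses.

Theorem proposition3p2 (R : realType) (d : nat) (CA CR lA lR : R) :
  (1 <= d)%N -> 0 < CA -> 0 < CR -> 0 < lA -> 0 < lR ->
  (forall a b : R, - d%:R < b -> b < a ->
     potential_hypotheses (@power_law R d a b)) /\
  (lR < lA -> CR / CA < (lA / lR) ^+ d ->
     potential_hypotheses (@morse R d CA CR lA lR)).
Proof.
move=> d0 CA0 CR0 lA0 lR0; split=> [a b db ba|lRA CRA].
  exact: power_law_hypotheses.
exact: morse_hypotheses.
Qed.
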